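(* Let $d\ge 2$ and let $\Xi=(\xi_t)_{t\in\mathbb{Z}^+}$ be a time-homogeneous Markov chain whose state-space $\mathcal{S}$ is an unbounded subset of $\mathbb{Z}^d$. Suppose that: (A1) there exist $\kappa>0$, $k\in\mathbb{N}$ and $n_0\in\mathbb{N}$ such that $\mathbb{P}[\xi_{t+n_0}-\xi_t=\mathbf{y}\mid \xi_t=\mathbf{x}]\ge\kappa$ for all $t\in\mathbb{Z}^+$, all $\mathbf{x}\in\mathcal{S}$ and all $\mathbf{y}\in\{\pm k\mathbf{e}_i: i=1,\dots,d\}$; (A2) there exists $B_0\in(0,\infty)$ such that $\mathbb{E}[\|\xi_{t+1}-\xi_t\|^2\mid\xi_t=\mathbf{x}]\le B_0$ for all $\mathbf{x}\in\mathcal{S}$. Let $\mu(\mathbf{x})=\mathbb{E}[\xi_{t+1}-\xi_t\mid\xi_t=\mathbf{x}]$ and suppose that for some $\beta\in(0,1)$, $c>0$, $\delta>0$ and $A_0>0$, $$\|\mathbf{x}\|^{\beta}\,\mu(\mathbf{x})\cdot\hat{\mathbf{x}}\ge c\quad\text{for all }\mathbf{x}\in\mathcal{S}\text{ with }\|\mathbf{x}\|>A_0,$$ and $$\sup_{\mathbf{x}\in\mathcal{S}:\,\|\mathbf{x}\|>A_0}\ \sup_{\mathbf{u}\in\mathbb{S}_d:\,\mathbf{u}\cdot\mathbf{x}=0}\|\mathbf{x}\|^{\beta+\delta}\,|\mu(\mathbf{x})\cdot\mathbf{u}|<\infty.$$ Then for any $\xi_0\in\mathcal{S}$ we have $\|\xi_t\|\to\infty$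 a.s., and there exists a random unit vector $\mathbf{v}\in\mathbb{S}_d$, whose distribution is supported on all of $\mathbb{S}_d$ (i.e. its support is the whole of $\mathbb{S}_d$), such that a.s. as $t\to\infty$ $$\frac{\xi_t}{\|\xi_t\|}\to\mathbf{v}.$$
   Context: $\mathbb{Z}^+=\{0,1,2,\dots\}$, $\mathbb{N}=\{1,2,\dots\}$. $\|\cdot\|$ is the Euclidean norm on $\mathbb{R}^d$, $\mathbf{e}_1,\dots,\mathbf{e}_d$ is the standard orthonormal basis, $\mathbf{u}\cdot\mathbf{v}$ is the scalar product, and $\hat{\mathbf{x}}=\mathbf{x}/\|\mathbf{x}\|$ for $\mathbf{x}\ne\mathbf{0}$. $\mathbb{S}_d:=\{\mathbf{u}\in\mathbb{R}^d:\|\mathbf{u}\|=1\}$ is the unit sphere in $\mathbb{R}^d$. The chain is not assumed spatially homogeneous. *)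

(* Defs.v *)
From HB Require Import structures.
From mathcomp Require Import all_boot all_order all_algebra.
From mathcomp Require Import all_classical all_reals all_analysis.

Set Implicit Arguments.
Unset Strict Implicit.
Unset Printing Implicit Defensive.

Import Order.TTheory GRing.Theory Num.Theory.
Import numFieldNormedType.Exports.

Local Open Scope classical_set_scope.
Local Open Scope ring_scope.

Definition dotp (R : realType) (d : nat) (u v : 'rV[R]_d) : R :=
  \sum_(i < d) u 0 i * v 0 i.

(* The library norm on 'rV[R]_d is the sup norm, hence a separate Euclidean
   norm. *)
Definition enorm (R : realType) (d : nat) (u : 'rV[R]_d) : R :=
  Num.sqrt (dotp u u).

Definition unit_sphere (R : realType) (d : nat) : set 'rV[R]_d :=
  [set u | enorm u = 1].
Arguments unit_sphere : clear implicits.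

Definition hat (R : realType) (d : nat) (u : 'rV[R]_d) : 'rV[R]_d :=
  (enorm u)^-1 *: u.

Definition emb (R : realType) (d : nat) (x : 'rV[int]_d) : 'rV[R]_d :=
  map_mx intr x.

Definition lattice_unbounded (R : realType) (d : nat) (S : set 'rV[int]_d) :=
  forall M : R, exists2 x, S x & M < enorm (emb R x).

Section conditioning.
Context {disp : measure_display} {Omega : measurableType disp} {R : realType}.
Implicit Types (P : probability Omega R) (A B : set Omega).

(* Conditioning on an event; meaningful when P B != 0. *)
Definition cprob P A B : R := fine (P (A `&` B)) / fine (P B).

Definition cexp P (X : Omega -> R) B : \bar R :=
  ((\int[P]_(w in B) (X w)%:E) * (fine (P B))^-1%:E)%E.

Definition random_vector (d : nat) (v : Omega -> 'rV[R]_d) :=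
  forall i : 'I_d, measurable_fun [set: Omega] (fun w => v w 0 i).

(* The topological support of the distribution of v under P. *)
Definition law_support P (d : nat) (v : Omega -> 'rV[R]_d) : set 'rV[R]_d :=
  [set u | forall e : R, 0 < e ->
     (0 < P [set w | (enorm (v w - u) < e)%R])%E].

End conditioning.

Section chain.
Context {disp : measure_display} {Omega : measurableType disp} {R : realType}.
Context {d : nat}.
Variables (S : set 'rV[int]_d) (Pr : 'rV[int]_d -> probability Omega R).
Variable xi : nat -> Omega -> 'rV[int]_d.

Definition at_state (t : nat) (x : 'rV[int]_d) : set Omega :=
  [set w | xi t w = x].

Definition incr (s t : nat) (w : Omega) : 'rV[int]_d := xi t w - xi s w.

(* [Pr x] is the law of the chain started at x; its values for x outside S
   play no role. The last clause expresses the Markov property and time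
   homogeneity together: the conditional law of xi t.+1 given the whole history
   h 0, .., h t is the law of xi 1 for the chain started at h t. *)
Definition markov_chain : Prop :=
  [/\ forall t x, measurable (at_state t x),
      forall t w, S (xi t w),
      forall x, S x -> Pr x (at_state 0 x) = 1%E
    & forall x0, S x0 -> forall (t : nat) (h : nat -> 'rV[int]_d) y,
        let H := [set w | forall s, (s <= t)%N -> xi s w = h s] in
        Pr x0 H != 0%E ->
        cprob (Pr x0) (at_state t.+1 y) H = fine (Pr (h t) (at_state 1 y))].

(* [given_state t x Q]: Q holds of the law of the chain, whatever the starting
   state for which conditioning on xi t = x makes sense. The choice x0 = x and
   t = 0 is always admissible. *)
Definition given_state (t : nat) (x : 'rV[int]_d)
    (Q : probability Omega R -> Prop) : Prop :=
  forall x0, S x0 -> Pr x0 (at_state t x) != 0%E -> Q (Pr x0).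

Definition is_drift (mu : 'rV[int]_d -> 'rV[R]_d) : Prop :=
  forall t x, S x -> given_state t x (fun P => forall i : 'I_d,
    cexp P (fun w => emb R (incr t t.+1 w) 0 i) (at_state t x)
      = (mu x 0 i)%:E).

Definition A1 : Prop :=
  exists kappa : R, exists k n0 : nat,
    [/\ 0 < kappa, (0 < k)%N, (0 < n0)%N
      & forall t x, S x -> forall (i : 'I_d) y,
          y = delta_mx 0 i *+ k \/ y = - (delta_mx 0 i *+ k) ->
          given_state t x (fun P =>
            kappa <= cprob P [set w | incr t (t + n0) w = y] (at_state t x))].

Definition A2 : Prop :=
  exists B0 : R, 0 < B0 /\
    forall t x, S x -> given_state t x (fun P =>
      (cexp P (fun w => enorm (emb R (incr t t.+1 w)) ^+ 2)%R (at_state t x)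
         <= B0%:E)%E).

End chain.

(* Main.v *)
Require Import Defs.
From HB Require Import structures.
From mathcomp Require Import all_boot all_order all_algebra.
From mathcomp Require Import all_classical all_reals all_analysis.
From mathcomp Require Import measurable_realfun ring lra.
Set Implicit Arguments.
Unset Strict Implicit.
Unset Printing Implicit Defensive.
Import Order.TTheory GRing.Theory Num.Theory.
Import numFieldNormedType.Exports.
Local Open Scope classical_set_scope.
Local Open Scope ring_scope.

(* For a unit vector u and small a > 0, put
     F_u(y) = 1 - hat y . u + max(1, |y|^2)^(-a).
   A second-order expansion, whose remainder is bounded by |increment|^2/|y|^2
   even for large increments, shows that F_u is superharmonic outside a ball
   that does not depend on u: the radial drift lowers the second term by
   |y|^(-1-beta-2a), which beats both the transverse drift and the second
   moments. The maximal inequality for F_u then bounds the probability that the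
   chain, started from y, ever enters the ball or leaves a cone around u. The
   bound tends to 0 as |y| grows when u = hat y. By (A1) the chain leaves every
   ball; restarting at the exit times gives transience and the Cauchy property
   of hat xi_t. For the support, (A1) also lets the chain reach, with positive
   probability, points y far away in any given direction u. *)

(** Radial movement leaves hat y unchanged, so at first order the angular term of F_u sees only the
    transverse drift; the sign of its conditional increment is unknown, and the decay term is there
    to compensate it. The assumption beta < 1 is what makes the |y|^(-2) of the second moments small
    against this compensation for some a > 0. Jumps are unbounded and only second moments are
    controlled, so each expansion must hold for every increment: increments shorter than half the
    current norm get a genuine Taylor bound, longer ones a crude bound that the quadratic remainder
    absorbs. Uniformity in u lets u be the direction of the chain at a random time. Since states are
    countable, conditional expectations become sums over the values of the chain, and the maximal
    inequality is an induction on a finite horizon, without stopped processes. *)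

Section euclidean.
Context {R : realType} {d : nat}.
Implicit Types (u v w : 'rV[R]_d) (a : R).

(** * Euclidean inner product and norm *)

Lemma dotpC u v : dotp u v = dotp v u.
Proof. by apply: eq_bigr => i _; rewrite mulrC. Qed.

Lemma dotpDl u v w : dotp (u + v) w = dotp u w + dotp v w.
Proof. by rewrite -big_split; apply: eq_bigr => i _; rewrite mxE mulrDl. Qed.

Lemma dotpZl a u v : dotp (a *: u) v = a * dotp u v.
Proof. by rewrite mulr_sumr; apply: eq_bigr => i _; rewrite mxE mulrA. Qed.

Lemma dotpNl u v : dotp (- u) v = - dotp u v.
Proof. by rewrite -scaleN1r dotpZl mulN1r. Qed.

Lemma dotpBl u v w : dotp (u - v) w = dotp u w - dotp v w.
Proof. by rewrite dotpDl dotpNl. Qed.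

Lemma dotpDr u v w : dotp u (v + w) = dotp u v + dotp u w.
Proof. by rewrite dotpC dotpDl !(dotpC u). Qed.

Lemma dotpZr a u v : dotp u (a *: v) = a * dotp u v.
Proof. by rewrite dotpC dotpZl dotpC. Qed.

Lemma dotpBr u v w : dotp u (v - w) = dotp u v - dotp u w.
Proof. by rewrite dotpC dotpBl !(dotpC u). Qed.

Lemma dotp_ge0 u : 0 <= dotp u u.
Proof. by apply: sumr_ge0 => i _; rewrite -expr2 sqr_ge0. Qed.

Lemma dotp_eq0 u : dotp u u = 0 -> u = 0.
Proof.
move=> /eqP; rewrite psumr_eq0; last by move=> i _; rewrite -expr2 sqr_ge0.
move=> /allP u0; apply/rowP => i; rewrite mxE; apply/eqP.
by have := u0 i (mem_index_enum _); rewrite /= mulf_eq0 orbb.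
Qed.

Lemma enorm_ge0 u : 0 <= enorm u.
Proof. exact: sqrtr_ge0. Qed.

Lemma sqr_enorm u : enorm u ^+ 2 = dotp u u.
Proof. by rewrite sqr_sqrtr// dotp_ge0. Qed.

Lemma enorm_eq0 u : enorm u = 0 -> u = 0.
Proof. by move=> u0; apply: dotp_eq0; rewrite -sqr_enorm u0 expr0n. Qed.

Lemma enormZ a u : enorm (a *: u) = `|a| * enorm u.
Proof.
by rewrite /enorm dotpZl dotpZr mulrA -expr2 sqrtrM ?sqr_ge0// sqrtr_sqr.
Qed.

Lemma dotp0r u : dotp u 0 = 0.
Proof. by rewrite -(scale0r 0) dotpZr mul0r. Qed.

Lemma enorm0 : enorm (0 : 'rV[R]_d) = 0.
Proof. by rewrite -(scale0r 0) enormZ normr0 mul0r. Qed.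

Lemma CauchySchwarz_dotp u v : `|dotp u v| <= enorm u * enorm v.
Proof.
rewrite -(@ler_pXn2r _ 2)// ?nnegrE ?mulr_ge0 ?enorm_ge0//.
rewrite exprMn !sqr_enorm -normrX ger0_norm ?sqr_ge0//.
have [v0|v0] := eqVneq (dotp v v) 0.
  by rewrite v0 mulr0 (dotp_eq0 v0) dotp0r expr0n.
have vp : 0 < dotp v v by rewrite lt_neqAle eq_sym v0 dotp_ge0.
have := dotp_ge0 (dotp v v *: u - dotp u v *: v).
rewrite !(dotpBl, dotpBr, dotpZl, dotpZr) (dotpC v u).
set x := dotp v v; set y := dotp u v; set z := dotp u u => h.
rewrite -subr_ge0 -(pmulr_rge0 _ vp); move: h; congr (0 <= _).
by rewrite -/x; ring.
Qed.

Lemma enormD u v : enorm (u + v) <= enorm u + enorm v.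
Proof.
rewrite -(@ler_pXn2r _ 2)// ?nnegrE ?addr_ge0 ?enorm_ge0//.
rewrite sqr_enorm !(dotpDl, dotpDr) -!sqr_enorm (dotpC v u).
by have := CauchySchwarz_dotp u v; rewrite ler_norml => /andP[_]; lra.
Qed.

Lemma enormN u : enorm (- u) = enorm u.
Proof. by rewrite -scaleN1r enormZ normrN1 mul1r. Qed.

Lemma coord_le_enorm u (i : 'I_d) : `|u 0 i| <= enorm u.
Proof.
rewrite -(@ler_pXn2r _ 2)// ?nnegrE ?enorm_ge0//.
rewrite sqr_enorm -normrX ger0_norm ?sqr_ge0// /dotp (bigD1 i)//= -expr2.
by rewrite lerDl; apply: sumr_ge0 => j _; rewrite -expr2 sqr_ge0.
Qed.

Lemma enorm_hat u : u != 0 -> enorm (hat u) = 1.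
Proof.
move=> u0; rewrite /hat enormZ ger0_norm ?invr_ge0 ?enorm_ge0// mulVf//.
by apply: contra_neq u0 => /enorm_eq0.
Qed.

Lemma enorm_hat_le1 u : enorm (hat u) <= 1.
Proof.
have [->|/enorm_hat->//] := eqVneq u 0.
by rewrite /hat scaler0 enorm0.
Qed.

End euclidean.

(** * One-step expansion of the Lyapunov function *)

Section scalar_bounds.
Context {R : realType}.
Implicit Types (a t s n : R).

(* With q = x/|x|, e = D/|x|, put al = q.u, ga = e.u, s = q.e, n = |e| and
   rho = |q + e|: a second-order expansion of (x + D)/|x + D| . u. *)
Lemma normalized_taylor_lb (al ga s n rho : R) :
  0 <= rho -> rho ^+ 2 = 1 + 2 * s + n ^+ 2 -> 0 <= n -> `|s| <= n ->
  `|al| <= 1 -> `|ga| <= n -> `|al + ga| <= rho ->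
  al + ga - s * al - 12 * n ^+ 2 <= (al + ga) / rho.
Proof.
move=> rho0 rhoE n0 sn al1 gan agr.
have sal : `|s * al| <= n by rewrite normrM (le_trans (ler_pM _ _ sn al1)) ?mulr1.
have sga : `|ga * s| <= n ^+ 2 by rewrite normrM expr2 ler_pM.
(* For n >= 1/2 the trivial bound -1 on the ratio suffices: the left side is at most 1 + 2n - 12n^2,
   which equals -1 at n = 1/2. This case fixes the constant 12. *)
have [n2|n2] := leP 2^-1 n.
  have : -1 <= (al + ga) / rho.
    have [r0|rp] := eqVneq rho 0; first by rewrite r0 invr0 mulr0 lerN10.
    have rp' : 0 < rho by rewrite lt_neqAle eq_sym rp.
    rewrite ler_pdivlMr// mulN1r.
    by move: agr; rewrite ler_norml => /andP[].
  have : 0 <= (n - 2^-1) * (n + 1) by rewrite mulr_ge0//; lra.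
  move: sal al1 gan; rewrite !ler_norml => /andP[? ?] /andP[? ?] /andP[? ?].
  nra.
have rlo : 1 - n <= rho.
  rewrite -(@ler_pXn2r _ 2)// ?nnegrE; [|lra].
  by rewrite rhoE; move: sn; rewrite ler_norml => /andP[? ?]; nra.
have rhi : rho <= 1 + n.
  rewrite -(@ler_pXn2r _ 2)// ?nnegrE; [|lra].
  by rewrite rhoE; move: sn; rewrite ler_norml => /andP[? ?]; nra.
have rp : 0 < rho by lra.
(* The remainder of 1/rho after its linear part 1 - s. The next identity shows that it is quadratic
   in n, and rho >= 1/2 gives rho (rho + 1) >= 3/4, whence the factor 6 = (9/2) / (3/4). *)
pose tau := rho^-1 - 1 + s.
have tauE : tau * (rho * (rho + 1)) = s * (rho - 1) * (rho + 2) - n ^+ 2.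
  have -> : n ^+ 2 = rho ^+ 2 - 1 - 2 * s by rewrite rhoE; ring.
  by rewrite /tau; field; lra.
have taun : `|tau| <= 6 * n ^+ 2.
  have : `|tau| * (rho * (rho + 1)) <= 9 / 2 * n ^+ 2.
    have -> : rho * (rho + 1) = `|rho * (rho + 1)|.
      by rewrite ger0_norm// mulr_ge0//; lra.
    rewrite -normrM tauE (le_trans (ler_normB _ _))//.
    rewrite (ger0_norm (sqr_ge0 n)) !normrM.
    have r1 : `|rho - 1| <= n by rewrite ler_norml; apply/andP; split; lra.
    have r2 : `|rho + 2| <= 7 / 2 by rewrite ler_norml; apply/andP; split; lra.
    have : `|s| * `|rho - 1| * `|rho + 2| <= n * n * (7 / 2).
      by rewrite ler_pM ?mulr_ge0// ler_pM.
    by rewrite expr2; lra.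
  have : 0 <= `|tau| * (rho * (rho + 1) - 3 / 4).
    by rewrite mulr_ge0//; nra.
  by rewrite mulrBr; have := normr_ge0 tau; lra.
have -> : (al + ga) / rho
    = al + ga - s * al + ((al + ga) * tau - ga * s).
  by rewrite /tau; field; lra.
have : `|(al + ga) * tau| <= 3 / 2 * (6 * n ^+ 2).
  by rewrite normrM ler_pM//; apply: le_trans agr _; lra.
move: sga; rewrite !ler_norml => /andP[? ?] /andP[? ?]; nra.
Qed.

(** Concavity: the tangent at 1 lies above the power. It is Young's inequality for t^a and 1, with
    conjugate exponents 1/a and 1/(1 - a). *)
Lemma powR_le_affine t a : 0 < t -> 0 < a < 1 -> t `^ a <= 1 + a * (t - 1).
Proof.
move=> t0 /andP[a0 a1].
have := @conjugate_powR R (t `^ a) 1 a^-1 (1 - a)^-1.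
rewrite powR_ge0 ler01 !invr_gt0 a0 subr_gt0 a1 !invrK subrKC.
move=> /(_ isT isT isT isT (erefl _)).
rewrite powR1 mulr1 mul1r -powRrM mulfV ?gt_eqF// (powRr1 (ltW t0)); lra.
Qed.

(* u = 1 + 2 s + n^2 is the ratio |x + D|^2 / |x|^2. *)
Lemma powRN_taylor_ub s n a : 0 < a < 1 -> `|s| <= n -> n <= 2^-1 ->
  (1 + 2 * s + n ^+ 2) `^ (- a) <= 1 - 2 * a * s + 25 * n ^+ 2.
Proof.
move=> /andP[a0 a1] sn n2.
have n0 : 0 <= n by apply: le_trans sn.
set u := _ + n ^+ 2.
have u4 : 4^-1 <= u.
  by rewrite /u; move: sn; rewrite ler_norml => /andP[? ?]; nra.
have up : 0 < u by lra.
rewrite powRN -[_^-1]mul1r.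
have -> : 1 / u `^ a = (u^-1) `^ a.
  by rewrite mul1r -!powR_inv1 ?powR_ge0 ?ltW// -!powRrM mulrC.
apply: le_trans (@powR_le_affine u^-1 a _ _) _; rewrite ?invr_gt0 ?a0//.
(* Uses 1/u - 1 = -(u - 1) + (u - 1)^2 / u. Since u >= 1/4 and |u - 1| <= 5n/2, the last term is at
   most 25 n^2. *)
have -> : 1 + a * (u^-1 - 1) = 1 - a * (u - 1) + a * ((u - 1) ^+ 2 / u).
  by field; lra.
have u1 : (u - 1) ^+ 2 <= 25 / 4 * n ^+ 2.
  have : `|u - 1| <= 5 / 2 * n.
    have nn : n ^+ 2 <= 2^-1 * n by rewrite expr2 ler_wpM2r.
    have := sqr_ge0 n; rewrite /u; move: sn; rewrite !ler_norml => /andP[? ?] ?.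
    by apply/andP; split; lra.
  rewrite -(@ler_pXn2r _ 2)// ?nnegrE ?mulr_ge0// -normrX ger0_norm ?sqr_ge0//.
  by rewrite exprMn; lra.
have : (u - 1) ^+ 2 / u <= 25 * n ^+ 2.
  by rewrite ler_pdivrMr//; have := sqr_ge0 n; nra.
have : 0 <= (u - 1) ^+ 2 / u by rewrite divr_ge0 ?sqr_ge0// ltW.
move=> p0 p1; have an : 0 <= a * n ^+ 2 by rewrite mulr_ge0 ?sqr_ge0// ltW.
have := le_trans (ler_piMl p0 (ltW a1)) p1.
have -> : a * (u - 1) = 2 * a * s + a * n ^+ 2 by rewrite /u; ring.
lra.
Qed.

Lemma powRN_small a r : 0 < a -> 0 < r ->
  exists2 N, 0 < N & forall M, N <= M -> M `^ (- a) <= r.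
Proof.
move=> a0 r0; exists (r `^ (- a^-1)) => [|M NM]; first exact: powR_gt0.
have N0 : 0 < r `^ (- a^-1) by exact: powR_gt0.
have -> : r = (r `^ (- a^-1)) `^ (- a).
  by rewrite -powRrM mulrNN mulVf ?gt_eqF// powRr1// ltW.
have M0 : 0 < M by exact: lt_le_trans NM.
rewrite !(powRN _ a) lef_pV2 ?posrE ?powR_gt0//.
by rewrite ge0_ler_powR ?nnegrE ?(ltW N0) ?(ltW M0) ?(ltW a0).
Qed.

End scalar_bounds.

Section lyapunov.
Context {R : realType} {d : nat}.
Implicit Types (a : R) (x y u D : 'rV[R]_d).

(** The truncation at 1 keeps the function bounded, even at the origin; the bound by 1 is what
    handles jumps of arbitrary size. *)
Definition decay a y : R := (Num.max 1 (enorm y ^+ 2)) `^ (- a).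

(* The term 1 - hat y . u is |hat y - u|^2 / 2 when y != 0. *)
Definition lyap a u y : R := 1 - dotp (hat y) u + decay a y.

Lemma decay_ge0 a y : 0 <= decay a y.
Proof. exact: powR_ge0. Qed.

Lemma decay_anti a x y : 0 <= a -> enorm x <= enorm y -> decay a y <= decay a x.
Proof.
move=> a0 xy; rewrite /decay !powRN lef_pV2 ?posrE ?powR_gt0 ?lt_max ?ltr01//.
have m0 (z : 'rV[R]_d) : 0 <= Num.max 1 (enorm z ^+ 2) by rewrite le_max ler01.
rewrite ge0_ler_powR ?nnegrE//.
by rewrite ge_max !le_max lexx/= ler_pXn2r ?nnegrE ?enorm_ge0// xy orbT.
Qed.

Lemma decay_le1 a y : 0 <= a -> decay a y <= 1.
Proof.
move=> a0; have -> : 1 = decay a (0 : 'rV[R]_d).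
  by rewrite /decay enorm0 expr0n max_l ?ler01// powR1.
by apply: decay_anti => //; rewrite enorm0 enorm_ge0.
Qed.

Lemma decayE a y : 1 <= enorm y -> decay a y = enorm y `^ (- (2 * a)).
Proof.
move=> y1; rewrite /decay max_r ?exprn_ege1//.
by rewrite -powR_mulrn ?enorm_ge0// -powRrM mulrN.
Qed.

Lemma dotp_hat_ge u y : enorm u = 1 -> 0 <= 1 - dotp (hat y) u.
Proof.
move=> u1; rewrite subr_ge0 (le_trans (ler_norm _))//.
by rewrite (le_trans (CauchySchwarz_dotp _ _))// u1 mulr1 enorm_hat_le1.
Qed.

Lemma lyap_ge0 a u y : enorm u = 1 -> 0 <= lyap a u y.
Proof. by move=> u1; rewrite addr_ge0 ?decay_ge0// dotp_hat_ge. Qed.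

Lemma sqr_enormD x y :
  enorm (x + y) ^+ 2 = enorm x ^+ 2 + 2 * dotp x y + enorm y ^+ 2.
Proof. by rewrite !sqr_enorm !(dotpDl, dotpDr) (dotpC y x); ring. Qed.

Lemma enorm_scale_sqr x D : x != 0 ->
  (enorm (x + D) / enorm x) ^+ 2 =
    1 + 2 * (dotp D (hat x) / enorm x) + (enorm D / enorm x) ^+ 2.
Proof.
move=> x0; have r0 : enorm x != 0 by apply: contra_neq x0 => /enorm_eq0.
rewrite expr_div_n sqr_enormD /hat dotpZr (dotpC D) expr_div_n.
by field.
Qed.

(** The condition 2 <= |x| makes the truncation inactive at x + D when |D| <= |x|/2, where the
    scalar expansion applies. For longer D, 1 + 2n is below the remainder 25 n^2. *)
Lemma decay_taylor a x D : 0 < a < 1 -> 2 <= enorm x ->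
  decay a (x + D) <= decay a x
    - 2 * a * decay a x * (dotp D (hat x) / enorm x)
    + 25 * (enorm D / enorm x) ^+ 2.
Proof.
move=> a01 x2; have /andP[a0 a1] := a01.
have rp : 0 < enorm x by lra.
have x0 : x != 0.
  by apply: contraTneq x2 => ->; rewrite -ltNge enorm0.
have := enorm_scale_sqr D x0.
set s := dotp D (hat x) / enorm x; set n := enorm D / enorm x => ratioE.
have n0 : 0 <= n by rewrite divr_ge0 ?enorm_ge0.
have sn : `|s| <= n.
  rewrite normrM normfV (ger0_norm (ltW rp)) ler_wpM2r ?invr_ge0 ?(ltW rp)//.
  by have := CauchySchwarz_dotp D (hat x); rewrite enorm_hat// mulr1.
have g0 := decay_ge0 a x; have g1 := decay_le1 x (ltW a0).
have [n2|n2] := leP n 2^-1; last first.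
  have := decay_le1 (x + D) (ltW a0).
  have : 2 * a * decay a x * s <= 2 * n.
    have ag : 0 <= a * decay a x <= 1.
      by rewrite mulr_ge0 ?(ltW a0)// mulr_ile1 ?(ltW a0) ?(ltW a1).
    have : a * decay a x * s <= 1 * n.
      case/andP: ag => ag0 ag1.
      by rewrite (le_trans (ler_wpM2l ag0 (ler_norm s)))// ler_pM.
    lra.
  have : 0 <= (n - 2^-1) * (n + 1) by rewrite mulr_ge0//; lra.
  nra.
have u4 : 4^-1 <= 1 + 2 * s + n ^+ 2.
  by move: sn; rewrite ler_norml => /andP[? ?]; nra.
have xDE : enorm (x + D) ^+ 2 = enorm x ^+ 2 * (1 + 2 * s + n ^+ 2).
  by rewrite -ratioE expr_div_n; field; lra.
have -> : decay a (x + D) = decay a x * (1 + 2 * s + n ^+ 2) `^ (- a).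
  rewrite /decay xDE !max_r.
  - by rewrite powRM ?sqr_ge0//; lra.
  - by rewrite exprn_ege1//; lra.
  - have h4 : 4 <= enorm x ^+ 2 by nra.
    by rewrite (le_trans _ (ler_pM _ _ h4 u4))// mulfV.
have := ler_wpM2l g0 (powRN_taylor_ub a01 sn n2).
have : decay a x * (25 * n ^+ 2) <= 25 * n ^+ 2.
  by rewrite ler_piMl// mulr_ge0// sqr_ge0.
lra.
Qed.

(** Dividing by |x| reduces to [normalized_taylor_lb]. The linear term is the component of D
    orthogonal to x, tested against u. *)
Lemma hat_taylor u x D : enorm u = 1 -> x != 0 ->
  dotp (hat x) u + dotp D u / enorm x
    - (dotp D (hat x) / enorm x) * dotp (hat x) u
    - 12 * (enorm D / enorm x) ^+ 2 <= dotp (hat (x + D)) u.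
Proof.
move=> u1 x0; have r0 : enorm x != 0 by apply: contra_neq x0 => /enorm_eq0.
have rp : 0 < enorm x by rewrite lt_neqAle eq_sym r0 enorm_ge0.
have nV (y : R) : `|y / enorm x| = `|y| / enorm x.
  by rewrite normrM normfV (ger0_norm (ltW rp)).
have -> : dotp (hat (x + D)) u = (dotp (hat x) u + dotp D u / enorm x)
    / (enorm (x + D) / enorm x).
  (* If x + D = 0, the convention 0^-1 = 0 makes both sides vanish. *)
  rewrite /hat !dotpZl dotpDl; have [->|?] := eqVneq (enorm (x + D)) 0.
    by rewrite mul0r invr0 !(mul0r, mulr0).
  by field; apply/andP.
apply: normalized_taylor_lb; rewrite ?enorm_scale_sqr ?divr_ge0 ?enorm_ge0//.
- rewrite nV ler_pM2r ?invr_gt0//.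
  by have := CauchySchwarz_dotp D (hat x); rewrite enorm_hat// mulr1.
- by have := CauchySchwarz_dotp (hat x) u; rewrite u1 enorm_hat// mulr1.
- rewrite nV ler_pM2r ?invr_gt0//.
  by have := CauchySchwarz_dotp D u; rewrite u1 mulr1.
- rewrite /hat dotpZl (mulrC _^-1) -mulrDl nV ler_pM2r ?invr_gt0// -dotpDl.
  by have := CauchySchwarz_dotp (x + D) u; rewrite u1 mulr1.
Qed.

(** The gradient of [lyap a u] at x when |x| > 1: ((hat x . u) hat x - u) / |x| comes from the
    angular term, the rest from the decay. *)
Definition lyap_slope a u x : 'rV[R]_d := (enorm x)^-1 *:
  ((dotp (hat x) u - 2 * a * decay a x) *: hat x - u).

Lemma dotp_lyap_slope a u x D : dotp D (lyap_slope a u x) = (enorm x)^-1 *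
  ((dotp (hat x) u - 2 * a * decay a x) * dotp D (hat x) - dotp D u).
Proof.
by rewrite /lyap_slope; move: (hat x) => q; rewrite dotpZr dotpBr dotpZr.
Qed.

(** Sum of the two expansions, whence 37 = 12 + 25. As D is arbitrary, it can be integrated using
    second moments alone. *)
Lemma lyap_taylor a u x D : 0 < a < 1 -> enorm u = 1 -> 2 <= enorm x ->
  lyap a u (x + D) <= lyap a u x + dotp D (lyap_slope a u x)
    + 37 * (enorm x)^-2 * enorm D ^+ 2.
Proof.
move=> a01 u1 x2; have x0 : x != 0.
  by apply: contraTneq x2 => ->; rewrite -ltNge enorm0.
have := decay_taylor D a01 x2; have := hat_taylor D u1 x0.
rewrite /lyap dotp_lyap_slope expr_div_n; lra.
Qed.

(* The transverse component of the drift moves hat by r^(-1-beta-delta), the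
   radial one lowers the decay by r^(-1-beta-2a): with 4a <= min(delta, 1-beta)
   the latter wins. *)
Lemma lyap_drift a (beta c delta K B : R) m u x :
  0 < a < 1 -> 4 * a <= delta -> 4 * a <= 1 - beta -> 0 <= K -> 0 <= B ->
  enorm u = 1 -> 1 <= enorm x ->
  (K + 37 * B) <= 2 * a * c * enorm x `^ (2 * a) ->
  c <= enorm x `^ beta * dotp m (hat x) ->
  (forall p, enorm p = 1 -> dotp p x = 0 ->
     enorm x `^ (beta + delta) * `|dotp m p| <= K) ->
  dotp m (lyap_slope a u x) + 37 * (enorm x)^-2 * B <= 0.
Proof.
move=> /andP[a0 a1] ad ab K0 B0 u1 x1 big hrad htr.
have rp : 0 < enorm x by lra.
have x0 : x != 0.
  by apply: contraTneq x1 => ->; rewrite -ltNge enorm0.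
have qq : dotp (hat x) (hat x) = 1 by rewrite -sqr_enorm enorm_hat// expr1n.
pose p := u - dotp (hat x) u *: hat x.
have px : dotp p x = 0.
  have -> : x = enorm x *: hat x.
    by rewrite /hat scalerA mulfV ?scale1r// gt_eqF.
  rewrite {}/p; move: (hat x) qq => q qq.
  by rewrite dotpZr dotpBl dotpZl qq mulr1 (dotpC u) subrr mulr0.
have p1 : enorm p <= 1.
  rewrite -(@ler_pXn2r _ 2)// ?nnegrE ?enorm_ge0// expr1n sqr_enorm /p.
  move: (hat x) qq => q qq.
  rewrite !(dotpBl, dotpBr, dotpZl, dotpZr) qq -(sqr_enorm u) u1 (dotpC u q).
  by have := sqr_ge0 (dotp q u); lra.
(* The transverse bound is homogeneous, so it passes from unit vectors to the projection p of u
   orthogonal to x, whose norm is at most 1. *)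
have mp : enorm x `^ (beta + delta) * `|dotp m p| <= K.
  have [p0|p0] := eqVneq p 0.
    by rewrite p0 dotp0r normr0 mulr0.
  have pn : enorm p != 0 by apply: contra_neq p0 => /enorm_eq0.
  have -> : dotp m p = enorm p * dotp m (hat p) by rewrite /hat dotpZr mulVKf.
  rewrite normrM ger0_norm ?enorm_ge0// mulrCA.
  have := htr (hat p); rewrite enorm_hat// {1}/hat dotpZl px mulr0.
  move=> /(_ erefl erefl) h; apply: le_trans h.
  by rewrite ler_piMl// mulr_ge0 ?powR_ge0.
have -> : dotp m (lyap_slope a u x) = (enorm x)^-1 *
    (- dotp m p - 2 * a * decay a x * dotp m (hat x)).
  rewrite dotp_lyap_slope /p dotpBr; move: (hat x) => q; rewrite dotpZr; ring.
rewrite (decayE _ x1).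
have -> : (enorm x)^-2 = (enorm x)^-1 * enorm x `^ (- 1).
  by rewrite powR_inv1 ?ltW// -invfM.
(* Both error terms are brought to the scale |x|^(-beta - 4a): the transverse one by 4a <= delta,
   the quadratic one by 4a <= 1 - beta. The radial gain |x|^(-beta - 2a) exceeds this scale by
   |x|^(2a), and [big] says that this factor outweighs the constants. *)
have m1 : - dotp m p <= K * enorm x `^ (- beta - 4 * a).
  have h : - dotp m p <= K * enorm x `^ (- (beta + delta)).
    rewrite (le_trans (ler_norm _))// normrN powRN ler_pdivlMr ?powR_gt0//.
    by rewrite mulrC.
  by apply: le_trans h _; rewrite ler_wpM2l// ler_powR//; lra.
have m2 : c * enorm x `^ (- beta) <= dotp m (hat x).
  by rewrite powRN ler_pdivrMr ?powR_gt0// mulrC.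
have m3 : enorm x `^ (- 1) <= enorm x `^ (- beta - 4 * a).
  by rewrite ler_powR//; lra.
have E1 : enorm x `^ (- (2 * a)) * enorm x `^ (- beta)
    = enorm x `^ (- beta - 4 * a) * enorm x `^ (2 * a).
  have x00 : enorm x != 0 by rewrite gt_eqF.
  by rewrite -!powRD ?x00 ?implybT//; congr (_ `^ _); lra.
set pm1 := enorm x `^ (- 1) in m3 *.
have -> : 37 * ((enorm x)^-1 * pm1) * B = (enorm x)^-1 * (37 * (pm1 * B)).
  by ring.
rewrite -mulrDr.
rewrite pmulr_rle0 ?invr_gt0//.
have G : 0 <= enorm x `^ (- beta - 4 * a) by exact: powR_ge0.
have h1 := ler_wpM2l G big.
have h2 : 2 * a * (enorm x `^ (- (2 * a)) * (c * enorm x `^ (- beta)))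
   <= 2 * a * (enorm x `^ (- (2 * a)) * dotp m (hat x)).
  by rewrite ler_wpM2l ?ler_wpM2l ?powR_ge0//; lra.
have h3 : 37 * (pm1 * B) <= 37 * (enorm x `^ (- beta - 4 * a) * B).
  by rewrite ler_wpM2l ?ler_wpM2r//; lra.
have E2 : 2 * a * (enorm x `^ (- (2 * a)) * (c * enorm x `^ (- beta))) =
  enorm x `^ (- beta - 4 * a) * (2 * a * c * enorm x `^ (2 * a)).
  by rewrite (mulrCA _ c) E1; ring.
lra.
Qed.

End lyapunov.

(** * Markov property and maximal inequality *)

Section countable_valued.
Context {disp : measure_display} {Omega : measurableType disp} {R : realType}.
Context {T : countType}.
Implicit Types (X Y : Omega -> T) (A B : set Omega).

Lemma measurable_countable_preimage X (D : set T) :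
  (forall y, measurable (X @^-1` [set y])) -> measurable (X @^-1` D).
Proof.
move=> mX.
have -> : X @^-1` D
    = \bigcup_y (if y \in D then X @^-1` [set y] else set0).
  apply/seteqP; split=> [w Dw|w [y _]].
    by exists (X w) => //; rewrite mem_set.
  by case: ifPn => // /set_mem Dy /= ->.
by apply: countable_bigcupT_measurable => // y; case: ifPn.
Qed.

Lemma measurable_fun_countable d' (U : measurableType d') X (f : T -> U) A :
  (forall y, measurable (X @^-1` [set y])) -> measurable A ->
  measurable_fun A (f \o X).
Proof.
move=> mX mA _ V mV; apply: measurableI => //.
exact: (measurable_countable_preimage (f @^-1` V) mX).
Qed.

(** Sums over T become series over codes in nat; a code that encodes no element of T gives an empty
    level and a zero term. *)
Let level X n := X @^-1` [set y | pickle y = n].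

Let measurable_level X n :
  (forall y, measurable (X @^-1` [set y])) -> measurable (level X n).
Proof. exact: measurable_countable_preimage. Qed.

Let levels X A : A = \bigcup_n (A `&` level X n).
Proof. by apply/seteqP; split=> [w Aw|w [n _ []//]]; exists (pickle (X w)). Qed.

Let trivIset_levels X A : trivIset setT (fun n => A `&` level X n).
Proof. by move=> i j _ _ [w [[_ <-] [_ <-]]]. Qed.

Let level_pickle X y : level X (pickle y) = X @^-1` [set y].
Proof.
by rewrite /level; apply/seteqP; split=> w /=; [exact: (pcan_inj pickleK)|move->].
Qed.

Let level_none X n : ~ (exists y : T, pickle y = n) -> level X n = set0.
Proof. by move=> nP; rewrite -subset0 => w wn; apply: nP; exists (X w). Qed.

Let measure_levels (mu : {measure set Omega -> \bar R}) X A :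
  (forall y, measurable (X @^-1` [set y])) -> measurable A ->
  mu A = (\sum_(n <oo) mu (A `&` level X n))%E.
Proof.
move=> mX mA; have mAn n : measurable (A `&` level X n).
  by apply: measurableI => //; exact: measurable_level.
rewrite [in LHS](levels X A) measure_semi_bigcup//.
exact: bigcupT_measurable.
Qed.

Let integral_levels (nu : {measure set Omega -> \bar R}) Y B (f : T -> R) :
  (forall y, measurable (Y @^-1` [set y])) -> measurable B ->
  (forall y, 0 <= f y) ->
  (\int[nu]_(w in B) (f (Y w))%:E
     = \sum_(n <oo) \int[nu]_(w in B `&` level Y n) (f (Y w))%:E)%E.
Proof.
move=> mY mB f0; rewrite [in LHS](levels Y B) ge0_integral_bigcup//.
- by move=> k; apply: measurableI => //; exact: measurable_level.
- rewrite -levels; apply/measurable_EFinP.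
  exact: (measurable_fun_countable f mY).
- by move=> w _; rewrite lee_fin.
Qed.

Let integral_level (nu : {measure set Omega -> \bar R}) Y B (f : T -> R) y :
  (forall y, measurable (Y @^-1` [set y])) -> measurable B ->
  (\int[nu]_(w in B `&` level Y (pickle y)) (f (Y w))%:E
     = (f y)%:E * nu (B `&` Y @^-1` [set y]))%E.
Proof.
move=> mY mB; rewrite level_pickle -integral_cst; last exact: measurableI.
by apply: eq_integral => w /set_mem[_ /= ->].
Qed.

(** Law of total probability, in place of conditional expectation. In the main use, X is the state
    at time m + 1 of one chain, Y the state at time 1 of a restarted chain, and f the probability of
    a later event from that state. *)
Lemma measure_eq_integral_fibers (mu nu : {measure set Omega -> \bar R})
    X Y A B (c : R) (f : T -> R) :
  (forall y, measurable (X @^-1` [set y])) ->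
  (forall y, measurable (Y @^-1` [set y])) ->
  measurable A -> measurable B -> (forall y, 0 <= f y) ->
  (forall y, mu (A `&` X @^-1` [set y])
     = c%:E * ((f y)%:E * nu (B `&` Y @^-1` [set y])))%E ->
  (mu A = c%:E * \int[nu]_(w in B) (f (Y w))%:E)%E.
Proof.
move=> mX mY mA mB f0 AB; rewrite (integral_levels _ mY)// -nneseriesZl.
  rewrite (measure_levels _ mX)//; apply: eq_eseriesr => n _.
  have [[y <-]|nP] := pselect (exists y : T, pickle y = n).
    by rewrite level_pickle AB -integral_level.
  by rewrite !level_none// !setI0 measure0 integral_set0 mule0.
by move=> n _; apply: integral_ge0 => w _; rewrite lee_fin.
Qed.

Lemma measure_le_integral_fibers (mu nu : {measure set Omega -> \bar R})
    X Y A B (c : R) (f : T -> R) :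
  (forall y, measurable (X @^-1` [set y])) ->
  (forall y, measurable (Y @^-1` [set y])) ->
  measurable A -> measurable B -> (forall y, 0 <= f y) ->
  (forall y, mu (A `&` X @^-1` [set y])
     <= c%:E * ((f y)%:E * nu (B `&` Y @^-1` [set y])))%E ->
  (mu A <= c%:E * \int[nu]_(w in B) (f (Y w))%:E)%E.
Proof.
move=> mX mY mA mB f0 AB; rewrite (integral_levels _ mY)// -nneseriesZl.
  rewrite (measure_levels _ mX)//; apply: lee_nneseries => // n _.
  have [[y <-]|nP] := pselect (exists y : T, pickle y = n).
    by rewrite level_pickle (le_trans (AB y))// -integral_level.
  by rewrite !level_none// !setI0 measure0 integral_set0 mule0.
by move=> n _; apply: integral_ge0 => w _; rewrite lee_fin.
Qed.

Lemma measure_le_fibers (mu : {measure set Omega -> \bar R}) X A B (c : R) :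
  (forall y, measurable (X @^-1` [set y])) -> measurable A -> measurable B ->
  0 <= c ->
  (forall y, mu (A `&` X @^-1` [set y])
     <= c%:E * mu (B `&` X @^-1` [set y]))%E ->
  (mu A <= c%:E * mu B)%E.
Proof.
move=> mX mA mB c0 AB.
rewrite -[mu B]mul1e -integral_cst//.
apply: (@measure_le_integral_fibers mu mu X X A B c (cst 1)) => // y.
by rewrite mul1e.
Qed.

End countable_valued.

Section chain.
Context {disp : measure_display} {Omega : measurableType disp} {R : realType}.
Context {d : nat}.
Variables (S : set 'rV[int]_d) (Pr : 'rV[int]_d -> probability Omega R).
Variable xi : nat -> Omega -> 'rV[int]_d.
Hypothesis hchain : markov_chain S Pr xi.

Lemma at_stateE t x : at_state xi t x = xi t @^-1` [set x].
Proof. by []. Qed.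

Lemma measurable_at_state t x : measurable (at_state xi t x).
Proof. by case: hchain. Qed.

Lemma chain_in_S t w : S (xi t w).
Proof. by case: hchain. Qed.

Lemma measurable_xi t (D : set 'rV[int]_d) : measurable [set w | D (xi t w)].
Proof. exact/measurable_countable_preimage/measurable_at_state. Qed.

(** Plays the role of the sigma-algebra of the past up to time m. No measurability is required:
    there are countably many paths of length m + 1, so it is automatic. *)
Definition historical m (H : set Omega) :=
  forall w w', (forall s, (s <= m)%N -> xi s w = xi s w') -> H w -> H w'.

Lemma historicalS m H : historical m H -> historical m.+1 H.
Proof. by move=> hH w w' ww'; apply: hH => s sm; apply: ww'; exact: leqW. Qed.

Lemma historical_state m s (D : set 'rV[int]_d) : (s <= m)%N ->
  historical m [set w | D (xi s w)].
Proof. by move=> sm w w' /(_ _ sm) /= ->. Qed.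

Lemma historicalI m H H' :
  historical m H -> historical m H' -> historical m (H `&` H').
Proof.
by move=> hH hH' w w' ww' [Hw H'w]; split; [exact: hH Hw|exact: hH' H'w].
Qed.

Let path m w : {ffun 'I_m.+1 -> 'rV[int]_d} := [ffun i : 'I_m.+1 => xi i w].

Let path_eq m w w' :
  (path m w = path m w') <-> (forall s, (s <= m)%N -> xi s w = xi s w').
Proof.
split=> [/ffunP e s sm|e]; last by apply/ffunP => i; rewrite !ffunE e// -ltnS.
by have := e (Ordinal (sm : (s < m.+1)%N)); rewrite !ffunE.
Qed.

Let measurable_path m q : measurable (path m @^-1` [set q]).
Proof.
have -> : path m @^-1` [set q] = \bigcap_(s in [set s | (s < m.+1)%N])
    [set w | forall h : (s < m.+1)%N, q (Ordinal h) = xi s w].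
  apply/seteqP; split=> [w /= <- s sm h|w qw]; first by rewrite ffunE.
  by apply/ffunP => -[s sm]; rewrite ffunE/= -(qw s sm sm).
apply: bigcap_measurableType => s sm.
exact: (measurable_xi s [set x | forall h : (s < m.+1)%N, q (Ordinal h) = x]).
Qed.

Lemma measurable_historical m H : historical m H -> measurable H.
Proof.
move=> hH; have -> : H = path m @^-1` (path m @` H).
  apply/seteqP; split=> [w Hw|w [w' Hw' /path_eq e]]; last exact: hH Hw'.
  by exists w.
exact: (measurable_countable_preimage _ (@measurable_path m)).
Qed.

Let fin_Pr x A : measurable A -> (fine (Pr x A))%:E = Pr x A.
Proof. by move=> mA; rewrite fineK// fin_num_measure. Qed.

(** H is a countable union of complete histories, each ending in y. The defining clause of the chain
    applies to those of positive probability; the null ones contribute zero to both sides. *)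
Lemma markov_step x0 m y z H : S x0 -> historical m H ->
  H `<=` at_state xi m y ->
  (Pr x0 (H `&` at_state xi m.+1 z) = Pr x0 H * Pr y (at_state xi 1 z))%E.
Proof.
move=> Sx0 hH Hy; have mH := measurable_historical hH.
pose p := fine (Pr y (at_state xi 1 z)).
have p0 : 0 <= p by exact: fine_ge0.
rewrite -(fin_Pr y); last exact: measurable_at_state.
transitivity (1%:E * \int[Pr x0]_(w in H) (cst p (path m w))%:E)%E; last first.
  by rewrite mul1e muleC -integral_cst.
apply: (measure_eq_integral_fibers (mu := Pr x0) (nu := Pr x0) (f := cst p)
  (measurable_path (m := m)) (measurable_path (m := m))) => //.
  by apply: measurableI => //; exact: measurable_at_state.
move=> q; rewrite mul1e.
have [[w0 Hw0 w0q]|nH] := pselect (exists2 w, H w & path m w = q); last first.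
  have nq : H `&` path m @^-1` [set q] = set0.
    by rewrite -subset0 => w [Hw wq]; apply: nH; exists w.
  by rewrite setIAC nq set0I !measure0 mule0.
have Hq : H `&` path m @^-1` [set q]
    = [set w | forall s, (s <= m)%N -> xi s w = xi s w0].
  apply/seteqP; split=> w /=.
    by move=> [_]; rewrite -w0q => /path_eq.
  move=> e; split; last by rewrite -w0q; apply/path_eq.
  by apply: hH Hw0 => s sm; rewrite e.
rewrite setIAC Hq; set C := [set w | _].
have mC : measurable C by rewrite /C -Hq; exact: measurableI.
have mCz : measurable (C `&` at_state xi m.+1 z).
  by apply: measurableI => //; exact: measurable_at_state.
change (Pr x0 (C `&` at_state xi m.+1 z) = (p%:E * Pr x0 C)%E).
have [C0|C0] := eqVneq (Pr x0 C) 0%E.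
  rewrite C0 mule0; apply/eqP; rewrite eq_le measure_ge0 andbT -[leRHS]C0.
  by apply: le_measure; rewrite ?inE//; exact: subIsetl.
case: hchain => _ _ _ /(_ x0 Sx0 m (fun s => xi s w0) z C0).
rewrite -/C /cprob (Hy _ Hw0) -/p setIC => pE.
rewrite -(fin_Pr _ mCz) -(fin_Pr _ mC) -EFinM -pE divfK//.
by rewrite fine_eq0 ?fin_num_measure.
Qed.

#[local] Hint Resolve measurable_at_state : core.

Lemma Pr_at_state0 y : S y -> Pr y (at_state xi 0 y) = 1%E.
Proof. by case: hchain => _ _ h _; exact: h. Qed.

Lemma Pr_start y A : S y -> measurable A ->
  Pr y (at_state xi 0 y `&` A) = Pr y A.
Proof.
move=> Sy mA; have m0 := measurable_at_state 0 y.
have c0 : Pr y (~` at_state xi 0 y) = 0%E.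
  by rewrite probability_setC// Pr_at_state0// subee.
rewrite -[in RHS](setIT A) -(setUv (at_state xi 0 y)) setIUr measureU.
- rewrite [X in (_ + X)%E](_ : _ = 0%E) ?adde0 1?setIC//.
  apply/eqP; rewrite eq_le measure_ge0 andbT -[leRHS]c0.
  have mC := measurableC m0.
  by apply: le_measure; rewrite ?inE//; exact: measurableI.
- exact: measurableI.
- by apply: measurableI => //; exact: measurableC.
- by rewrite setIACA setICr setI0.
Qed.

Lemma state_set0 t x : ~ S x -> at_state xi t x = set0.
Proof.
by move=> nS; rewrite -subset0 => w wx; apply: nS; rewrite -wx; exact: chain_in_S.
Qed.

(** The integral on the right depends on y, n and z only. Comparing the case of a general H with
    that of the chain started at y at time 0 identifies it with the (n+1)-step probability. *)
Let markov_split x0 m n y z H :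
  (forall x0 m y H, S x0 -> S y -> historical m H -> H `<=` at_state xi m y ->
    Pr x0 (H `&` at_state xi (m + n) z) = Pr x0 H * Pr y (at_state xi n z))%E ->
  S x0 -> S y -> historical m H -> H `<=` at_state xi m y ->
  (Pr x0 (H `&` at_state xi (m + n.+1) z) = Pr x0 H *
    \int[Pr y]_(w in at_state xi 0 y) (fine (Pr (xi 1 w) (at_state xi n z)))%:E)%E.
Proof.
move=> IH Sx0 Sy hH Hy; have mH := measurable_historical hH.
rewrite -(fin_Pr _ mH); apply: (measure_eq_integral_fibers
    (f := fun x => fine (Pr x (at_state xi n z)))
    (measurable_at_state m.+1) (measurable_at_state 1)) => //.
- exact: measurableI.
- by move=> x; exact: fine_ge0.
move=> x; rewrite !fin_Pr//= -!at_stateE.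
have [Sx|nS] := pselect (S x); last first.
  by rewrite !(state_set0 _ nS) !setI0 !measure0 !mule0.
have hHx : historical m.+1 (H `&` at_state xi m.+1 x).
  apply: historicalI; first exact: historicalS.
  exact: (historical_state (D := [set x])).
rewrite setIAC addnS -addSn (IH _ _ x)//.
rewrite (markov_step _ Sx0 hH Hy) Pr_start//.
by rewrite -muleA (muleC (Pr x _)).
Qed.

Lemma markov_steps n x0 m y z H : S x0 -> S y -> historical m H ->
  H `<=` at_state xi m y ->
  (Pr x0 (H `&` at_state xi (m + n) z) = Pr x0 H * Pr y (at_state xi n z))%E.
Proof.
elim: n x0 m y H => [|n IH] x0 m y H Sx0 Sy hH Hy.
  rewrite addn0; have [<-|yz] := eqVneq y z.
    by rewrite Pr_at_state0// mule1; congr (Pr x0 _); apply/setIidPl.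
  have d0 t : at_state xi t y `&` at_state xi t z = set0.
    by rewrite -subset0 => w [wy wz]; move/eqP: yz; apply; rewrite -wy.
  rewrite (_ : H `&` _ = set0); last first.
    by rewrite -subset0 -(d0 m); exact: setSI.
  by rewrite -(Pr_start Sy)// d0 !measure0 mule0.
rewrite (markov_split IH Sx0 Sy hH Hy); congr (_ * _)%E.
have h0 : historical 0 (at_state xi 0 y).
  exact: (historical_state (D := [set y])).
by have := markov_split IH Sy Sy h0 (@subset_refl _ _);
  rewrite Pr_start// Pr_at_state0// mul1e.
Qed.

Let measurable_visit (D : set 'rV[int]_d) m n :
  measurable [set w | exists2 s, (s <= n)%N & D (xi (m + s)%N w)].
Proof.
have -> : [set w | exists2 s, (s <= n)%N & D (xi (m + s)%N w)]
    = \bigcup_(s in [set s | (s <= n)%N]) [set w | D (xi (m + s)%N w)].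
  by apply/seteqP; split=> w [s sn Ds]; exists s.
by apply: bigcup_measurable => s _; exact: measurable_xi.
Qed.

(** Induction on the horizon. If y is in D, then F y >= 1 is enough. Otherwise the visit happens
    from time m + 1 on; the bound for the shorter horizon, averaged over the next state, gives the
    mean of F after one step, which is at most F y. Hence superharmonicity is only asked outside
    D. *)
Lemma superharmonic_maximal (D : set 'rV[int]_d) (F : 'rV[int]_d -> R) :
  (forall x, 0 <= F x) -> (forall x, D x -> 1 <= F x) ->
  (forall x, S x -> ~ D x ->
     \int[Pr x]_(w in at_state xi 0 x) (F (xi 1 w))%:E <= (F x)%:E)%E ->
  forall n x0 m y H, S x0 -> S y -> historical m H ->
    H `<=` at_state xi m y ->
  (Pr x0 (H `&` [set w | exists2 s, (s <= n)%N & D (xi (m + s)%N w)])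
    <= (F y)%:E * Pr x0 H)%E.
Proof.
move=> F0 F1 FP.
elim=> [|n IH] x0 m y H Sx0 Sy hH Hy; have mH := measurable_historical hH.
  have [Dy|nDy] := pselect (D y).
    rewrite (@le_trans _ _ (1 * Pr x0 H)%E)//; last first.
      by rewrite lee_wpmul2r// lee_fin F1.
    by rewrite mul1e le_measure ?inE//; apply: measurableI => //;
    exact: measurable_visit.
  rewrite (_ : _ `&` _ = set0) ?measure0 ?mule_ge0 ?lee_fin//.
  rewrite -subset0 => w [/Hy wy [s]]; rewrite leqn0 => /eqP ->.
  by rewrite addn0 wy.
have [Dy|nDy] := pselect (D y).
  rewrite (@le_trans _ _ (1 * Pr x0 H)%E)//; last first.
    by rewrite lee_wpmul2r// lee_fin F1.
  by rewrite mul1e le_measure ?inE//; apply: measurableI => //;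
    exact: measurable_visit.
rewrite (_ : _ `&` _ =
    H `&` [set w | exists2 s, (s <= n)%N & D (xi (m.+1 + s)%N w)]); last first.
  apply/seteqP; split=> w [Hw [s sn Ds]]; split=> //; last first.
    by exists s.+1; rewrite // addnS -addSn.
  case: s sn Ds => [_|s sn Ds]; last by exists s; rewrite // addSn -addnS.
  by rewrite addn0 (Hy _ Hw).
rewrite muleC; apply: (@le_trans _ _ ((fine (Pr x0 H))%:E *
    \int[Pr y]_(w in at_state xi 0 y) (F (xi 1%N w))%:E)%E); last first.
  by rewrite fin_Pr// lee_wpmul2l// FP.
apply: (measure_le_integral_fibers
    (measurable_at_state m.+1) (measurable_at_state 1)) => //.
  by apply: measurableI => //; exact: measurable_visit.
move=> x; rewrite -!at_stateE.
have [Sx|nS] := pselect (S x); last first.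
  by rewrite !(state_set0 _ nS) !setI0 !measure0 !mule0.
have hHx : historical m.+1 (H `&` at_state xi m.+1 x).
  apply: historicalI; first exact: historicalS.
  exact: (historical_state (D := [set x])).
rewrite setIAC (le_trans (IH _ _ x _ _ _ _ _))//.
by rewrite (markov_step _ Sx0 hH Hy) /= Pr_start// (fin_Pr _ mH) muleCA.
Qed.

Lemma superharmonic_maximal_ever (D : set 'rV[int]_d) (F : 'rV[int]_d -> R) :
  (forall x, 0 <= F x) -> (forall x, D x -> 1 <= F x) ->
  (forall x, S x -> ~ D x ->
     \int[Pr x]_(w in at_state xi 0 x) (F (xi 1 w))%:E <= (F x)%:E)%E ->
  forall x0 m y H, S x0 -> S y -> historical m H ->
    H `<=` at_state xi m y ->
  (Pr x0 (H `&` [set w | exists s, D (xi (m + s)%N w)])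
    <= (F y)%:E * Pr x0 H)%E.
Proof.
move=> F0 F1 FP x0 m y H Sx0 Sy hH Hy; have mH := measurable_historical hH.
pose E n := H `&` [set w | exists2 s, (s <= n)%N & D (xi (m + s)%N w)].
have mE n : measurable (E n).
  by apply: measurableI => //; exact: measurable_visit.
have EU : \bigcup_n E n = H `&` [set w | exists s, D (xi (m + s)%N w)].
  apply/seteqP; split=> [w [n _ [Hw [s _ Ds]]]|w [Hw [s Ds]]].
    by split=> //; exists s.
  by exists s => //; split=> //; exists s.
have cE : Pr x0 (E n) @[n --> \oo] --> Pr x0 (\bigcup_n E n).
  apply: nondecreasing_cvg_mu => //; first exact: bigcupT_measurable.
  move=> n n' nn'; apply/subsetPset => w [Hw [s sn Ds]]; split=> //.
  by exists s => //; exact: leq_trans nn'.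
rewrite -EU -(cvg_lim _ cE)//; apply: lime_le.
  by apply/cvg_ex; eexists; exact: cE.
by near=> n; exact: superharmonic_maximal.
Unshelve. all: by end_near.
Qed.

End chain.

(** * Superharmonicity of the Lyapunov function along the chain *)

Section drift.
Context {disp : measure_display} {Omega : measurableType disp} {R : realType}.
Context {d : nat}.

Lemma integral_le_quadratic (P : probability Omega R) (E : set Omega)
    (V : Omega -> 'rV[R]_d) (f : Omega -> R) (L C B : R) (l m : 'rV[R]_d) :
  measurable E -> P E = 1%E -> measurable_fun E f ->
  (forall i, measurable_fun E (fun w => V w 0 i)) ->
  (forall w, E w -> 0 <= f w) -> 0 <= C ->
  (forall w, E w -> f w <= L + dotp (V w) l + C * enorm (V w) ^+ 2) ->
  (forall i, \int[P]_(w in E) (V w 0 i)%:E = (m 0 i)%:E)%E ->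
  (\int[P]_(w in E) (enorm (V w) ^+ 2)%:E <= B%:E)%E ->
  (\int[P]_(w in E) (f w)%:E <= (L + dotp m l + C * B)%:E)%E.
Proof.
move=> mE PE mf mV f0 C0 fle Vm VB.
have mV2 : measurable_fun E (fun w => enorm (V w) ^+ 2).
  apply: (eq_measurable_fun (fun w => \sum_(i < d) V w 0 i * V w 0 i)).
    by move=> w _; rewrite sqr_enorm.
  by apply: measurable_sum => i; exact: measurable_funM.
have iV2 : P.-integrable E (EFin \o (fun w => enorm (V w) ^+ 2)).
  apply/integrableP; split; first exact/measurable_EFinP.
  under eq_integral do rewrite /= ger0_norm ?sqr_ge0//.
  by apply: le_lt_trans VB _; rewrite ltry.
have icst (r : R) : P.-integrable E (EFin \o cst r).
  by apply: finite_measure_integrable_cst.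
have iV i : P.-integrable E (EFin \o (fun w => V w 0 i)).
  (* Each coordinate is dominated by 1 + |V|^2, so the second moment alone makes the linear term
     integrable. *)
  apply: (le_integrable mE _ _ (integrableD mE (icst 1) iV2)).
    exact/measurable_EFinP.
  move=> w _ /=; rewrite lee_fin.
  have e2 := sqr_ge0 (enorm (V w)).
  rewrite (le_trans (coord_le_enorm (V w) i))// ger0_norm; last first.
    by rewrite addr_ge0.
  by have := sqr_ge0 (enorm (V w) - 1); rewrite sqrrB1; lra.
have iVl i : P.-integrable E (fun w => ((l 0 i)%:E * (V w 0 i)%:E)%E).
  exact: (integrableZl mE _ (iV i)).
have iVls : P.-integrable E
    (fun w => (\sum_(i < d) (l 0 i)%:E * (V w 0 i)%:E)%E).
  by apply: integrable_sum => // i _; exact: iVl.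
have iV2C : P.-integrable E (fun w => (C%:E * (enorm (V w) ^+ 2)%:E)%E).
  exact: (integrableZl mE _ iV2).
apply: (@le_trans _ _ (\int[P]_(w in E) (L%:E + (\sum_(i < d)
    (l 0 i)%:E * (V w 0 i)%:E) + C%:E * (enorm (V w) ^+ 2)%:E))%E).
  apply: ge0_le_integral => //.
  - exact/measurable_EFinP.
  - apply: emeasurable_funD; last by case/integrableP: iV2C.
    by apply: emeasurable_funD; [exact: measurable_cst|case/integrableP: iVls].
  - move=> w Ew; under eq_bigr do rewrite -EFinM.
    rewrite sumEFin -!EFinM -!EFinD lee_fin (le_trans (fle _ Ew))//.
    by rewrite lerD2r lerD2l; apply: ler_sum => i _; rewrite mulrC.
rewrite integralD//; last by apply: integrableD => //; exact: (icst L).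
rewrite integralD//; last exact: (icst L).
have -> : (\int[P]_(w in E) L%:E = L%:E)%E.
  by have := integral_cst P mE L%:E; rewrite /= PE mule1.
rewrite integral_sum//.
rewrite integralZl// !EFinD; apply: leeD; last first.
  by rewrite EFinM lee_wpmul2l// lee_fin.
rewrite leeD2l//.
rewrite /dotp -sumEFin; apply: lee_sum => i _.
by rewrite EFinM -Vm muleC; have /= -> := integralZl mE (iV i) (l 0 i).
Qed.

Variables (S : set 'rV[int]_d) (Pr : 'rV[int]_d -> probability Omega R).
Variable xi : nat -> Omega -> 'rV[int]_d.
Hypothesis hchain : markov_chain S Pr xi.

Lemma integral_lyap_le (a B : R) (m u : 'rV[R]_d) x :
  0 < a < 1 -> enorm u = 1 -> S x -> 2 <= enorm (emb R x) ->
  (forall i, cexp (Pr x) (fun w => emb R (incr xi 0 1 w) 0 i)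
     (at_state xi 0 x) = (m 0 i)%:E) ->
  (cexp (Pr x) (fun w => enorm (emb R (incr xi 0 1 w)) ^+ 2)%R
     (at_state xi 0 x) <= B%:E)%E ->
  dotp m (lyap_slope a u (emb R x)) + 37 * (enorm (emb R x))^-2 * B <= 0 ->
  (\int[Pr x]_(w in at_state xi 0 x) (lyap a u (emb R (xi 1 w)))%:E
     <= (lyap a u (emb R x))%:E)%E.
Proof.
move=> a01 u1 Sx x2 hm hB hdrift.
have a0 : 0 <= a by case/andP: a01 => /ltW.
(* Under the law started at x, the conditioning event at time 0 has probability 1, so the
   conditional expectation is a plain integral. *)
have cexpE (f : Omega -> R) : cexp (Pr x) f (at_state xi 0 x)
    = (\int[Pr x]_(w in at_state xi 0 x) (f w)%:E)%E.
  by rewrite /cexp (Pr_at_state0 hchain Sx)/= invr1 mule1.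
have mS := measurable_at_state hchain.
pose X w := (xi 0 w, xi 1 w).
have mX p : measurable (X @^-1` [set p]).
  rewrite [_ @^-1` _](_ : _ = at_state xi 0 p.1 `&` at_state xi 1 p.2).
    exact: measurableI.
  case: p => y z; apply/seteqP; split=> w; first by case=> <- <-.
  by case=> /= <- <-.
apply: (@le_trans _ _ (lyap a u (emb R x) + dotp m (lyap_slope a u (emb R x))
    + 37 * (enorm (emb R x))^-2 * B)%:E); last first.
  by rewrite lee_fin; lra.
apply: (@integral_le_quadratic _ _ (fun w => emb R (incr xi 0 1 w))) => //.
- exact: (Pr_at_state0 hchain).
- exact: (measurable_fun_countable (fun y => lyap a u (emb R y)) (mS 1)).
- move=> i.
  exact: (measurable_fun_countable (fun p => emb R (p.2 - p.1) 0 i) mX).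
- by move=> w _; exact: lyap_ge0.
- by rewrite mulr_ge0// invr_ge0 sqr_ge0.
- move=> w wx; have -> : emb R (xi 1 w) = emb R x + emb R (incr xi 0 1 w).
    by rewrite /incr (wx : xi 0 w = x) /emb -map_mxD addrC subrK.
  exact: lyap_taylor.
- by move=> i; rewrite -cexpE.
- by rewrite -cexpE.
Qed.

End drift.

(** * Lattice points reached by the steps of (A1) *)

Section excursions.
Context {disp : measure_display} {Omega : measurableType disp} {R : realType}.
Context {d : nat}.
Variables (S : set 'rV[int]_d) (Pr : 'rV[int]_d -> probability Omega R).
Variable xi : nat -> Omega -> 'rV[int]_d.
Hypothesis hchain : markov_chain S Pr xi.

(** S is not assumed invariant under translations; membership of a point in S is read off from a
    positive probability of being there. *)
Lemma state_in_S (p : R) x n y : 0 < p ->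
  (p%:E <= Pr x (at_state xi n y))%E -> S y.
Proof.
move=> p0; have [//|nS] := pselect (S y).
by rewrite (state_set0 hchain _ nS) measure0 lee_fin leNgt p0.
Qed.

Lemma Pr_at_state_comp (p q : R) x m y n z : S x -> 0 < p -> 0 <= q ->
  (p%:E <= Pr x (at_state xi m y))%E -> (q%:E <= Pr y (at_state xi n z))%E ->
  ((p * q)%:E <= Pr x (at_state xi (m + n) z))%E.
Proof.
move=> Sx p0 q0 hp hq; have Sy := state_in_S p0 hp.
have mS := measurable_at_state hchain.
apply: (@le_trans _ _ (Pr x (at_state xi m y `&` at_state xi (m + n) z))).
  rewrite (markov_steps hchain _ _ Sx Sy)//.
    by rewrite EFinM lee_pmul// ?lee_fin// ltW.
  exact: (historical_state (D := [set y])).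
by apply: le_measure; rewrite ?inE//; exact: measurableI.
Qed.

Lemma A1_step : A1 S Pr xi -> exists kappa : R, exists k n0 : nat,
  [/\ 0 < kappa, (0 < k)%N & forall x, S x -> forall (i : 'I_d) y,
    y = delta_mx 0 i *+ k \/ y = - (delta_mx 0 i *+ k) ->
    (kappa%:E <= Pr x (at_state xi n0 (x + y)%R))%E].
Proof.
move=> [kappa [k [n0 [kap k0 _ h]]]]; exists kappa, k, n0.
split=> // x Sx i y hy.
have := h 0 x Sx i y hy x Sx.
rewrite (Pr_at_state0 hchain Sx) add0n => /(_ onee_neq0).
rewrite /cprob (Pr_at_state0 hchain Sx) divr1.
have -> : [set w | incr xi 0 n0 w = y] `&` at_state xi 0 x
    = at_state xi 0 x `&` at_state xi n0 (x + y).
  apply/seteqP; split=> w [].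
    by rewrite /= /incr => <- wx; split=> //;
      rewrite /at_state /= -wx addrC subrK.
  by move=> wx wy; split=> //; rewrite /= /incr wx wy addrC addKr.
have mS := measurable_at_state hchain.
by rewrite (Pr_start hchain Sx)// -lee_fin fineK// fin_num_measure.
Qed.

Variables (kappa : R) (k n0 : nat).
Hypothesis kappa_gt0 : 0 < kappa.
Hypothesis step : forall x, S x -> forall (i : 'I_d) y,
  y = delta_mx 0 i *+ k \/ y = - (delta_mx 0 i *+ k) ->
  (kappa%:E <= Pr x (at_state xi n0 (x + y)%R))%E.

(** The displacements z that are possible from every state are closed under addition and contain all
    unit vectors and their opposites, hence exhaust the lattice. The factor k is the length of the
    steps. *)
Lemma reach_lattice (z : 'rV[int]_d) x : S x ->
  exists n, exists2 p : R, 0 < p &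
    (p%:E <= Pr x (at_state xi n (x + z *+ k)%R))%E.
Proof.
pose reach (z : 'rV[int]_d) := forall x, S x -> exists n, exists2 p : R, 0 < p &
  (p%:E <= Pr x (at_state xi n (x + z *+ k)%R))%E.
have reachD z1 z2 : reach z1 -> reach z2 -> reach (z1 + z2).
  move=> h1 h2 y Sy; have [n1 [p1 p10 hp1]] := h1 y Sy.
  have [n2 [p2 p20 hp2]] := h2 _ (state_in_S p10 hp1).
  exists (n1 + n2)%N; exists (p1 * p2); first exact: mulr_gt0.
  by rewrite mulrnDl addrA; apply: Pr_at_state_comp hp2 => //; exact: ltW.
have reach0 : reach 0.
  move=> y Sy; exists 0; exists 1 => //.
  by rewrite mul0rn addr0 (Pr_at_state0 hchain Sy).
have reachMn z1 n : reach z1 -> reach (z1 *+ n).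
  by move=> h; elim: n => [|n IH]; rewrite ?mulr0n// mulrS; exact: reachD.
suff: reach z by exact.
rewrite [z]row_sum_delta; apply: (big_ind reach) => // i _.
have reach_delta : reach (delta_mx 0 i).
  by move=> y Sy; exists n0; exists kappa => //; apply: (step Sy (i := i)); left.
have reach_deltaN : reach (- delta_mx 0 i).
  move=> y Sy; exists n0; exists kappa => //; apply: (step Sy (i := i)); right.
  by rewrite mulNrn.
case: (intP (z 0 i)) => [|n|n].
- by rewrite scale0r.
- by rewrite -natz scaler_nat; exact: reachMn.
- by rewrite scaleNr -natz scaler_nat -mulNrn; exact: reachMn.
Qed.

(** Unlike in [reach_lattice], duration and probability do not depend on x; the geometric argument
    for leaving balls needs this uniformity. *)
Lemma line_steps (i : 'I_d) J x : S x ->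
  ((kappa ^+ J)%:E <=
    Pr x (at_state xi (J * n0) (x + delta_mx 0 i *+ (k * J))%R))%E.
Proof.
move=> Sx; elim: J => [|J IH].
  by rewrite expr0 mul0n muln0 mulr0n addr0 (Pr_at_state0 hchain Sx).
have SJ := state_in_S (exprn_gt0 J kappa_gt0) IH.
rewrite exprSr mulSnr mulnS (addnC k) mulrnDr addrA.
apply: (Pr_at_state_comp Sx _ _ IH) => //.
- exact: exprn_gt0.
- exact: ltW.
- by apply: (step SJ (i := i)); left.
Qed.

End excursions.

(** * Lattice points as real vectors, and a lower bound on the decay *)

Section embedding.
Context {R : realType} {d : nat}.

Lemma embD (x y : 'rV[int]_d) : emb R (x + y) = emb R x + emb R y.
Proof. exact: map_mxD. Qed.

Lemma embMn (x : 'rV[int]_d) n : emb R (x *+ n) = n%:R *: emb R x.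
Proof. by rewrite /emb raddfMn scaler_nat. Qed.

Lemma enorm_emb_delta (i : 'I_d) : enorm (emb R (delta_mx 0 i)) = 1.
Proof.
rewrite /enorm /dotp (bigD1 i)//= !mxE !eqxx mulr1 big1 ?addr0 ?sqrtr1//.
move=> j ji.
by rewrite !mxE (negbTE ji) andbF mul0r.
Qed.

Lemma decay_lb (a A : R) (y : 'rV[R]_d) : 0 <= a -> 1 <= A -> enorm y <= A ->
  A `^ (- (2 * a)) <= decay a y.
Proof.
move=> a0 A_ge1 yA; have A0 : 0 <= A by lra.
rewrite /decay -mulrN powRrM powR_mulrn// !powRN.
rewrite lef_pV2 ?posrE ?powR_gt0 ?lt_max ?ltr01// ?exprn_gt0//; last by lra.
have m0 : 0 <= Num.max 1 (enorm y ^+ 2) by rewrite le_max ler01.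
rewrite ge0_ler_powR ?nnegrE// ?exprn_ge0// ge_max exprn_ege1//=.
by rewrite ler_pXn2r ?nnegrE ?enorm_ge0.
Qed.

End embedding.

(** * Almost sure exit from every ball *)

Section exit_ball.
Context {disp : measure_display} {Omega : measurableType disp} {R : realType}.
Context {d : nat}.
Variables (S : set 'rV[int]_d) (Pr : 'rV[int]_d -> probability Omega R).
Variable xi : nat -> Omega -> 'rV[int]_d.
Hypothesis hchain : markov_chain S Pr xi.
Variables (kappa : R) (k n0 : nat).
Hypothesis kappa_gt0 : 0 < kappa.
Hypothesis k_gt0 : (0 < k)%N.
Hypothesis step : forall x, S x -> forall (i : 'I_d) y,
  y = delta_mx 0 i *+ k \/ y = - (delta_mx 0 i *+ k) ->
  (kappa%:E <= Pr x (at_state xi n0 (x + y)%R))%E.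

Let inside M t := [set w | enorm (emb R (xi t w)) < M].

Let measurable_inside M t : measurable (inside M t).
Proof. exact: (measurable_xi hchain t [set x | enorm (emb R x) < M]). Qed.

Let exit_chance (i : 'I_d) M : exists J, forall x0 m x H,
  S x0 -> S x -> historical xi m H -> H `<=` at_state xi m x ->
  enorm (emb R x) < M ->
  (Pr x0 (H `&` inside M (m + J * n0)) <= (1 - kappa ^+ J)%:E * Pr x0 H)%E.
Proof.
(* A displacement of length at least 2|M| carries every point of the ball of radius M out of it. *)
pose J := Num.bound (`|M| + `|M|).
exists J => x0 m x H Sx0 Sx hH Hx xM.
have mH := measurable_historical hchain hH.
have mS := measurable_at_state hchain.
pose z : 'rV[int]_d := x + delta_mx 0 i *+ (k * J).
have zM : M <= enorm (emb R z).
  have kJ : `|M| + `|M| <= (k * J)%:R.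
    apply: ltW; apply: (lt_le_trans (archi_boundP _)); first exact: addr_ge0.
    by rewrite ler_nat leq_pmull.
  have : (k * J)%:R <= enorm (emb R z) + enorm (emb R x).
    have <- : enorm ((k * J)%:R *: emb R (delta_mx 0 i : 'rV[int]_d))
        = (k * J)%:R.
      by rewrite enormZ enorm_emb_delta mulr1 ger0_norm.
    rewrite -(enormN (emb R x)); apply: le_trans (enormD _ _).
    by rewrite /z embD embMn addrAC subrr add0r.
  have := ler_norm M; lra.
have Sz : S z.
  by apply: (state_in_S hchain _ (line_steps hchain kappa_gt0 step i J Sx));
    exact: exprn_gt0.
have zle : ((kappa ^+ J)%:E * Pr x0 H
    <= Pr x0 (H `&` at_state xi (m + J * n0) z))%E.
  rewrite (markov_steps hchain _ _ Sx0 Sx hH Hx) muleC lee_wpmul2l//.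
  exact: (line_steps hchain kappa_gt0 step i J Sx).
have -> : ((1 - kappa ^+ J)%:E * Pr x0 H
    = Pr x0 H - (kappa ^+ J)%:E * Pr x0 H)%E.
  rewrite -[Pr x0 H]fineK ?fin_num_measure// -!EFinM -EFinB; congr EFin; ring.
apply: (@le_trans _ _ (Pr x0 (H `\` at_state xi (m + J * n0) z))).
  apply: le_measure; rewrite ?inE; [exact: measurableI|exact: measurableD|].
  move=> w [Hw wM]; split=> // wz; move: wM; rewrite /inside /=.
  by rewrite (wz : xi _ w = z) ltNge zM.
rewrite measureD//; last by rewrite (le_lt_trans (probability_le1 _ _))// ltry.
exact: leeB.
Qed.

(** Sampled at the multiples of J * n0, the chain has a fixed chance of being outside at each next
    sample, so the probability of having always been inside decays geometrically. *)
Lemma exit_ball (i : 'I_d) M x0 : S x0 ->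
  Pr x0 [set w | forall t, enorm (emb R (xi t w)) < M] = 0%E.
Proof.
move=> Sx0; have [J hJ] := exit_chance i M.
pose L := (J * n0)%N; pose q := 1 - kappa ^+ J.
have mS := measurable_at_state hchain.
have q0 : 0 <= q.
  rewrite subr_ge0 -lee_fin.
  by rewrite (le_trans (line_steps hchain kappa_gt0 step i J Sx0))//
    probability_le1.
have q1 : q < 1 by rewrite ltrBlDr ltrDl exprn_gt0.
pose G j := \bigcap_(s in [set s | (s <= j)%N]) inside M (s * L)%N.
have hG j : historical xi (j * L) (G j).
  move=> w w' ww' Gw s sj; have := Gw s sj; rewrite /inside /= ww'//.
  by rewrite leq_mul2r sj orbT.
have PG j : (Pr x0 (G j) <= (q ^+ j)%:E)%E.
  elim: j => [|j IH].
    by rewrite expr0 probability_le1//; exact: (measurable_historical hchain).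
  have mG s : measurable (G s) by exact: (measurable_historical hchain).
  apply: (@le_trans _ _ (q%:E * Pr x0 (G j))%E); last first.
    by rewrite exprS EFinM lee_wpmul2l ?lee_fin.
  apply: (measure_le_fibers (mS (j * L)%N)) => // y.
  have [Sy|nS] := pselect (S y); last first.
    by rewrite -at_stateE (state_set0 hchain _ nS) !setI0 !measure0 mule0.
  have [yM|yM] := ltP (enorm (emb R y)) M; last first.
    rewrite [G _ `&` _](_ : _ = set0) ?measure0 ?mule_ge0 ?lee_fin//.
    rewrite -subset0 => w [/(_ j)]; rewrite /inside /= leqnSn => /(_ isT) wM wy.
    by move: wM; rewrite wy ltNge yM.
  apply: le_trans (hJ x0 (j * L)%N y (G j `&` at_state xi (j * L) y)
    Sx0 Sy _ _ yM) => //; last first.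
    by apply: historicalI => //; exact: (historical_state (D := [set y])).
  apply: le_measure; rewrite ?inE.
  - by apply: measurableI => //; exact: mS.
  - by apply: measurableI => //; exact: measurableI.
  move=> w [Gw wy]; split; first split=> //.
    by move=> s /= sj; apply: Gw; exact: leqW.
  by rewrite addnC -mulSn; apply: Gw => /=.
apply/eqP; rewrite eq_le measure_ge0 andbT; apply/lee_addgt0Pr => e e0.
rewrite add0e.
have [j qj] : exists j, q ^+ j < e.
  have /cvgrPdist_lt/(_ _ e0) : (fun n => q ^+ n) @ \oo --> (0 : R).
    by apply: cvg_expr; rewrite ger0_norm.
  case=> N _ /(_ N (leqnn N)); rewrite /= sub0r normrN ger0_norm ?exprn_ge0//.
  by exists N.
apply: (@le_trans _ _ (q ^+ j)%:E); last by rewrite lee_fin ltW.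
apply: le_trans (PG j); apply: le_measure; rewrite ?inE.
- rewrite (_ : [set w | _] = \bigcap_t inside M t); last first.
    by apply/seteqP; split=> w wM t => [_|]; exact: wM.
  exact: bigcapT_measurable.
- exact: (measurable_historical hchain).
- by move=> w wM s _; exact: wM.
Qed.

End exit_ball.

(** * Confinement to truncated cones *)

Section confinement.
Context {disp : measure_display} {Omega : measurableType disp} {R : realType}.
Context {d : nat}.
Variables (S : set 'rV[int]_d) (Pr : 'rV[int]_d -> probability Omega R).
Variable xi : nat -> Omega -> 'rV[int]_d.
Hypothesis hchain : markov_chain S Pr xi.
Variables a rho0 : R.
Hypothesis a01 : 0 < a < 1.
Hypothesis rho_ge1 : 1 <= rho0.
Hypothesis lyap_super : forall (u : 'rV[R]_d) x, enorm u = 1 -> S x ->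
  rho0 <= enorm (emb R x) ->
  (\int[Pr x]_(w in at_state xi 0 x) (lyap a u (emb R (xi 1 w)))%:E
     <= (lyap a u (emb R x))%:E)%E.

(** The complement, for A > 0, is the truncated cone of points of norm at least A whose direction is
    at distance less than sqrt(2 eta) from the unit vector u. *)
Definition strays A eta (u : 'rV[R]_d) (x : 'rV[int]_d) :=
  enorm (emb R x) < A \/ eta <= 1 - dotp (hat (emb R x)) u.

(** A lower bound of [lyap a u] on the stray set: either the angular term is at least eta or the
    decay is at least A^(-2a). *)
Definition threshold A eta := Num.min eta (A `^ (- (2 * a))).

Lemma threshold_gt0 A eta : rho0 <= A -> 0 < eta -> 0 < threshold A eta.
Proof. by move=> AA e0; rewrite lt_min e0 powR_gt0//; have := rho_ge1; lra. Qed.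

Lemma prob_strays_le A eta u x0 m y H : rho0 <= A -> 0 < eta -> enorm u = 1 ->
  S x0 -> S y -> historical xi m H -> H `<=` at_state xi m y ->
  (Pr x0 (H `&` [set w | exists s, strays A eta u (xi (m + s)%N w)])
    <= (lyap a u (emb R y) / threshold A eta)%:E * Pr x0 H)%E.
Proof.
move=> AA e0 u1 Sx0 Sy hH Hy; have a0 : 0 <= a by case/andP: a01 => /ltW.
have th0 := threshold_gt0 AA e0.
have mS := measurable_at_state hchain.
apply: (superharmonic_maximal_ever hchain (D := strays A eta u)
  (F := fun x => lyap a u (emb R x) / threshold A eta)) => //.
- by move=> x; rewrite divr_ge0 ?lyap_ge0// ltW.
- move=> x; rewrite ler_pdivlMr// mul1r /threshold => -[xA|xe].
    rewrite ge_min orbC (le_trans (decay_lb a0 _ (ltW xA)))//.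
      by have := rho_ge1; lra.
    by rewrite lerDr dotp_hat_ge.
  by rewrite ge_min (le_trans xe)// lerDl decay_ge0.
- move=> x Sx nx.
  have xA : rho0 <= enorm (emb R x).
    by apply: le_trans AA _; rewrite leNgt; apply/negP => ?; apply: nx; left.
  under eq_integral do rewrite mulrC EFinM.
  rewrite ge0_integralZl//.
  + rewrite [leRHS]EFinM muleC lee_wpmul2r ?lee_fin ?invr_ge0 ?(ltW th0)//.
    exact: lyap_super.
  + apply/measurable_EFinP.
    exact: (measurable_fun_countable (fun y => lyap a u (emb R y)) (mS 1)).
  + by move=> w _; rewrite lee_fin lyap_ge0.
  + by rewrite lee_fin invr_ge0 ltW.
Qed.

Hypothesis exits : forall M x0, S x0 ->
  Pr x0 [set w | forall t, enorm (emb R (xi t w)) < M] = 0%E.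

(** The reference direction is that of the chain at time m itself. Off this event, the chain stays
    from some time on in the cone around its own position at that time. *)
Let wanders A eta := [set w | forall m, exists s,
  strays A eta (hat (emb R (xi m w))) (xi (m + s)%N w)].

Lemma measurable_wanders A eta : measurable (wanders A eta).
Proof.
have -> : wanders A eta = \bigcap_m \bigcup_s
    [set w | strays A eta (hat (emb R (xi m w))) (xi (m + s)%N w)].
  apply/seteqP; split=> w /= h m; first by move=> _; have [s] := h m; exists s.
  by have [s _ hs] := h m I; exists s.
have mS := measurable_at_state hchain.
apply: bigcapT_measurable => m; apply: bigcupT_measurable => s.
pose X w := (xi m w, xi (m + s)%N w).
have mX p : measurable (X @^-1` [set p]).
  rewrite [_ @^-1` _](_ : _ = at_state xi m p.1 `&` at_state xi (m + s) p.2).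
    exact: measurableI.
  case: p => y z; apply/seteqP; split=> w; first by case=> <- <-.
  by case=> /= <- <-.
exact: (measurable_countable_preimage
  [set p | strays A eta (hat (emb R p.1)) p.2] mX).
Qed.

(** Wandering means straying after every time, in particular after the first time the norm reaches
    M. That time is almost surely finite, and straying after it has probability at most r once M is
    large. *)
Lemma wanders_null A eta x0 : rho0 <= A -> 0 < eta -> S x0 ->
  Pr x0 (wanders A eta) = 0%E.
Proof.
move=> AA e0 Sx0; have /andP[a0 a1] := a01; have mW := measurable_wanders A eta.
have th0 := threshold_gt0 AA e0.
have mS := measurable_at_state hchain.
apply/eqP; rewrite eq_le measure_ge0 andbT; apply/lee_addgt0Pr => r r0.
rewrite add0e.
have [M [MA Mr]] : exists M, A <= M /\ M `^ (- (2 * a)) / threshold A eta <= r.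
  have [|N _ hN] := @powRN_small _ (2 * a) (r * threshold A eta) _
    (mulr_gt0 r0 th0); first lra.
  exists (Num.max A N); split; first by rewrite le_max lexx.
  by rewrite ler_pdivrMr// hN// le_max lexx orbT.
(* The event that the norm reaches M for the first time at m; these events are disjoint. *)
pose E m := [set w | forall s, (s < m)%N -> enorm (emb R (xi s w)) < M] `&`
  [set w | M <= enorm (emb R (xi m w))].
have hE m : historical xi m (E m).
  apply: historicalI.
    by move=> w w' ww' Ew s sm; rewrite -ww'; [exact: Ew|exact: ltnW].
  exact: (historical_state (D := [set x | M <= enorm (emb R x)])).
have mE m : measurable (E m) by exact: (measurable_historical hchain (hE m)).
have tE : trivIset setT E.
  move=> i j _ _ [w [[i1 i2] [j1 j2]]]; case: (ltngtP i j) => // ij.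
    by move: (j1 _ ij); rewrite ltNge i2.
  by move: (i1 _ ij); rewrite ltNge j2.
have WE m : (Pr x0 (wanders A eta `&` E m) <= r%:E * Pr x0 (E m))%E.
  apply: (measure_le_fibers (mS m)) => //; [exact: measurableI|exact: ltW|].
  move=> y; rewrite -at_stateE.
  have [Sy|nS] := pselect (S y); last first.
    by rewrite (state_set0 hchain _ nS) !setI0 !measure0 mule0.
  have [yM|yM] := leP M (enorm (emb R y)); last first.
    have -> : E m `&` at_state xi m y = set0.
      rewrite -subset0 => w [[_ /= wM] wy].
      by move: wM; rewrite (wy : xi m w = y) leNgt yM.
    rewrite setIAC -setIA [X in _ `&` X](_ : _ = set0).
      by rewrite setI0 measure0 mule0.
    rewrite -subset0 => w [wy [_ /= wM]].
    by move: wM; rewrite (wy : xi m w = y) leNgt yM.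
  have y0 : emb R y != 0.
    apply: contraTneq yM => ->; rewrite enorm0 -ltNge.
    by have := rho_ge1; lra.
  have hEy : historical xi m (E m `&` at_state xi m y).
    by apply: historicalI => //; exact: (historical_state (D := [set y])).
  have mEy := measurable_historical hchain hEy.
  apply: (@le_trans _ _ (Pr x0 ((E m `&` at_state xi m y) `&` [set w | exists s,
      strays A eta (hat (emb R y)) (xi (m + s)%N w)]))).
    apply: le_measure; rewrite ?inE.
    - by rewrite -setIA; exact: measurableI.
    - apply: measurableI => //.
      rewrite (_ : [set w | _] = \bigcup_s
          [set w | strays A eta (hat (emb R y)) (xi (m + s)%N w)]).
        apply: bigcupT_measurable => s.
        exact: (measurable_xi hchain _ (strays A eta (hat (emb R y)))).
      by apply/seteqP; split=> w [s]; [exists s|move=> _; exists s].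
    move=> w [[Ww Ew] wy]; split=> //; have := Ww m.
    by rewrite (wy : xi m w = y).
  apply: le_trans (prob_strays_le AA e0 (enorm_hat y0) Sx0 Sy hEy _) _ => //.
  rewrite lee_wpmul2r// lee_fin (le_trans _ Mr)//.
  (* With u = hat y the angular term vanishes and only the decay, at most M^(-2a), is left. *)
  rewrite ler_pM2r ?invr_gt0// /lyap -sqr_enorm enorm_hat// expr1n subrr add0r.
  rewrite decayE; last by have := rho_ge1; lra.
  rewrite !powRN lef_pV2 ?posrE ?powR_gt0//; [|by have := rho_ge1; lra..].
  by rewrite ge0_ler_powR ?nnegrE//; have := rho_ge1; lra.
have cover : wanders A eta `<=` [set w | forall t, enorm (emb R (xi t w)) < M]
    `|` \bigcup_m (wanders A eta `&` E m).
  move=> w Ww; have [wM|] := pselect (exists t, M <= enorm (emb R (xi t w))).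
    right; case: (ex_minnP wM) => m mM mmin; exists m => //; split=> //.
    split=> // s sm; rewrite ltNge; apply/negP => /mmin.
    by rewrite leqNgt sm.
  move=> nM; left => t; rewrite ltNge; apply/negP => tM; apply: nM.
  by exists t.
have mN : measurable [set w | forall t, enorm (emb R (xi t w)) < M].
  rewrite (_ : [set w | _] = \bigcap_t [set w | enorm (emb R (xi t w)) < M]).
    apply: bigcapT_measurable => t.
    exact: (measurable_xi hchain t [set x | enorm (emb R x) < M]).
  by apply/seteqP; split=> w wM t => [_|]; exact: wM.
have mU : measurable (\bigcup_m (wanders A eta `&` E m)).
  by apply: bigcupT_measurable => m; exact: measurableI.
apply: (@le_trans _ _ (Pr x0 (\bigcup_m (wanders A eta `&` E m)))).
  apply: le_trans (le_measure _ _ _ cover) _; rewrite ?inE//.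
    exact: measurableU.
  apply: le_trans (measureU2 _ _ _) _ => //=; by rewrite exits// add0e.
rewrite measure_semi_bigcup//; [|by move=> m; exact: measurableI|].
  apply: (@le_trans _ _ (\sum_(m <oo) r%:E * Pr x0 (E m))%E).
    by apply: lee_nneseries => // m _; exact: WE.
  rewrite nneseriesZl// -measure_semi_bigcup//; last exact: bigcupT_measurable.
  rewrite -[leRHS]mule1 lee_wpmul2l ?lee_fin ?(ltW r0)//.
  by rewrite probability_le1//; exact: bigcupT_measurable.
by move=> i j _ _ [w [[_ Ei] [_ Ej]]]; apply: tE => //; exists w.
Qed.

End confinement.

(** * Convergence of directions along one path, and lattice points in a given direction *)

Section directions.
Context {R : realType} {d : nat}.

(** Row vectors carry the topology of the sup norm; this crude comparison, with d instead of sqrt d,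
    links it to the Euclidean norm. *)
Lemma enorm_le_sup (v : 'rV[R]_d) (e : R) : 0 <= e ->
  (forall i, `|v 0 i| <= e) -> enorm v <= d%:R * e.
Proof.
move=> e0 ve; rewrite -(@ler_pXn2r _ 2)// ?nnegrE ?enorm_ge0 ?mulr_ge0//.
have d2 : d%:R <= d%:R ^+ 2 :> R.
  by rewrite -natrX ler_nat -mulnn;
  case: (d) => // n; rewrite leq_pmulr.
rewrite sqr_enorm exprMn; apply: (@le_trans _ _ (d%:R * e ^+ 2)).
  rewrite mulr_natl -[d in leRHS]card_ord -sumr_const; apply: ler_sum => i _.
  by rewrite -expr2 -real_normK ?num_real// ler_pXn2r ?nnegrE.
by rewrite ler_wpM2r// sqr_ge0.
Qed.

Lemma sqr_enorm_unitB (u v : 'rV[R]_d) : enorm u = 1 -> enorm v = 1 ->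
  enorm (u - v) ^+ 2 = 2 * (1 - dotp u v).
Proof.
by move=> u1 v1; rewrite sqr_enormD enormN u1 v1 -scaleN1r dotpZr; ring.
Qed.

Lemma cvg_enorm_lt (x : nat -> 'rV[R]_d) (l : 'rV[R]_d) : x @ \oo --> l ->
  forall e : R, 0 < e -> \forall t \near \oo, enorm (l - x t) < e.
Proof.
move=> xl e e0; have e1 : 0 < e / d.+1%:R by rewrite divr_gt0.
have /cvg_ballP/(_ _ e1) := xl; apply: filterS => t [_ lt].
apply: (@le_lt_trans _ _ (d%:R * (e / d.+1%:R))).
  apply: enorm_le_sup => [|i]; first exact: ltW.
  by have := lt 0 i; rewrite /ball /= !mxE => /ltW.
rewrite mulrCA -[ltRHS]mulr1 ltr_pM2l// ltr_pdivrMr// mul1r ltr_nat//.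
Qed.

(** At level n the chain ends up at norm at least rho0 + n, which gives divergence, and in a cone of
    aperture parameter 1/(n+1), which gives the Cauchy property. *)
Lemma direction_cvg (x : nat -> 'rV[int]_d) (rho0 : R) : 1 <= rho0 ->
  (forall n : nat, exists m, forall s, ~ strays (rho0 + n%:R) (n.+1%:R^-1)
     (hat (emb R (x m))) (x (m + s)%N)) ->
  enorm (emb R (x t)) @[t --> \oo] --> +oo /\
  exists2 l : 'rV[R]_d, enorm l = 1 & hat (emb R (x t)) @[t --> \oo] --> l.
Proof.
move=> rho_ge1 hx.
have far n : exists m, forall t, (m <= t)%N ->
    rho0 + n%:R <= enorm (emb R (x t)) /\
    1 - dotp (hat (emb R (x t))) (hat (emb R (x m))) < n.+1%:R^-1.
  have [m hm] := hx n; exists m => t mt; have := hm (t - m)%N.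
  rewrite subnKC// => ns; split.
    by rewrite leNgt; apply/negP => h; apply: ns; left.
  by rewrite ltNge; apply/negP => h; apply: ns; right.
have nz t : rho0 <= enorm (emb R (x t)) -> emb R (x t) != 0.
  by move=> h; apply: contraTneq h => ->; rewrite enorm0 -ltNge; lra.
have xoo : enorm (emb R (x t)) @[t --> \oo] --> +oo.
  apply/cvgryPge => A; have [m hm] := far (Num.bound `|A|).
  exists m => // t /hm[+ _]; apply: le_trans.
  have := archi_boundP (normr_ge0 A); have := ler_norm A; lra.
split=> //.
have cx : cvg (hat (emb R (x t)) @[t --> \oo]).
  apply: cauchy_cvg; apply: cauchy_exP => e e0.
  (* For unit vectors the squared distance is 2 (1 - p . q), here less than 2/(n+1) < e^2. *)
  pose n := Num.bound (2 / e ^+ 2).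
  have en : 2 * n.+1%:R^-1 < e ^+ 2.
    rewrite -ltr_pdivlMl// mulrC -invf_div.
    rewrite ltf_pV2 ?posrE ?divr_gt0 ?exprn_gt0//.
    have := @archi_boundP _ (2 / e ^+ 2); rewrite divr_ge0 ?sqr_ge0//.
    by move=> /(_ isT) /lt_trans; apply; rewrite ltr_nat.
  have [m hm] := far n; exists (hat (emb R (x m))); exists m => // t mt.
  have [tA td] := hm t mt; have [mA _] := hm m (leqnn m).
  have n0 : 0 <= n%:R :> R by [].
  have te : enorm (hat (emb R (x m)) - hat (emb R (x t))) < e.
    rewrite -(@ltr_pXn2r _ 2)// ?nnegrE ?enorm_ge0 ?ltW//.
    rewrite sqr_enorm_unitB ?enorm_hat ?nz//; [|lra..].
    by rewrite dotpC (lt_trans _ en)// ltr_pM2l.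
  split=> // i j; rewrite (ord1 i) /ball /=.
  have := coord_le_enorm (hat (emb R (x m)) - hat (emb R (x t))) j.
  by rewrite !mxE => h; exact: le_lt_trans te.
exists (lim (hat (emb R (x t)) @[t --> \oo])) => //.
have dist := cvg_enorm_lt cx.
set l := lim _ in dist *.
apply/eqP; rewrite -subr_eq0 -normr_le0; apply/ler_addgt0Pl => e e0.
rewrite addr0.
have [m hm] := far 0; have [N _ hN] := dist e e0.
pose t := maxn m N; have [tA _] := hm t (leq_maxl _ _).
have {hN} := hN t (leq_maxr _ _); rewrite /= => hN.
have h1 : enorm (hat (emb R (x t))) = 1.
  by apply: enorm_hat; apply: nz; rewrite addr0 in tA.
have := enormD (l - hat (emb R (x t))) (hat (emb R (x t))).
have := enormD (hat (emb R (x t)) - l) l.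
rewrite !subrK -(enormN (_ - l)) opprB h1 => h2 h3.
by rewrite ler_norml; apply/andP; split; lra.
Qed.

(* y = x0 + k z with z the integer part of L u, for L large. *)
Lemma small_lyap_in_direction (a r : R) (u : 'rV[R]_d) (x0 : 'rV[int]_d) k :
  0 < a -> 0 < r -> enorm u = 1 -> (0 < k)%N ->
  exists z, lyap a u (emb R (x0 + z *+ k)) <= r.
Proof.
move=> a0 r0 u1 k0.
have [||N N0 hN] := @powRN_small _ (2 * a) (r / 2) _ _; [lra|lra|].
pose W := enorm (emb R x0) + k%:R * d%:R.
have W0 : 0 <= W by rewrite addr_ge0 ?enorm_ge0// mulr_ge0.
(* W bounds |y - T u|: it is |x0| plus the rounding error k d. From T > b, |y| exceeds N and 1, as
   the decay requires, and also 4W/r, so that 1 - hat y . u <= 2W/|y| <= r/2. *)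
pose b := W + N + 1 + 4 * W / r.
have Wr0 : 0 <= 4 * W / r by rewrite divr_ge0 ?mulr_ge0// ltW.
have b0 : 0 <= b by rewrite /b; lra.
pose L := Num.bound b.
have bL : b < L%:R by exact: archi_boundP.
pose T : R := k%:R * L%:R.
have bT : b < T.
  by apply: lt_le_trans bL _; rewrite ler_peMl// ler1n.
pose z : 'rV[int]_d := \row_j Num.floor (L%:R * u 0 j).
exists z; set y := emb R _.
pose w := y - T *: u.
have wW : enorm w <= W.
  have -> : w = emb R x0 + k%:R *: (emb R z - L%:R *: u).
    by rewrite /w /y embD embMn /T scalerBr scalerA addrA.
  rewrite (le_trans (enormD _ _))// lerD2l enormZ ger0_norm// ler_wpM2l//.
  rewrite -[leRHS]mulr1 enorm_le_sup// => i; rewrite !mxE.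
  have /andP[f1 f2] := floor_itv (L%:R * u 0 i).
  rewrite intrD in f2.
  by rewrite ler_norml; apply/andP; split; lra.
have yE : y = T *: u + w by rewrite /w addrC subrK.
have T0 : 0 <= T by rewrite mulr_ge0.
have TE : enorm (T *: u) = T by rewrite enormZ u1 mulr1 ger0_norm.
have ylo : T - W <= enorm y.
  have := enormD y (- w); rewrite {1}yE addrK enormN TE; lra.
have yhi : enorm y <= T + W.
  by rewrite yE (le_trans (enormD _ _))// TE lerD2l.
have yu : T - W <= dotp y u.
  rewrite yE dotpDl dotpZl -sqr_enorm u1 expr1n mulr1.
  have := CauchySchwarz_dotp w u; rewrite u1 mulr1 ler_norml => /andP[]; lra.
have rp : 0 < enorm y by rewrite /b in bT; lra.
have hatu : 1 - dotp (hat y) u <= r / 2.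
  have -> : dotp (hat y) u = dotp y u / enorm y by rewrite /hat dotpZl mulrC.
  rewrite lerBlDl -lerBlDr ler_pdivlMr//.
  have : 4 * W <= r * enorm y.
    rewrite (mulrC r) -ler_pdivrMr//; rewrite /b in bT; lra.
  lra.
have dec : decay a y <= r / 2.
  rewrite decayE; last by rewrite /b in bT; lra.
  by apply: hN; rewrite /b in bT; lra.
by rewrite /lyap; lra.
Qed.

End directions.

(** * Choice of constants, construction of the limit direction, and its support *)

Theorem theorem2p2 (R : realType) (d : nat) (hd : (2 <= d)%N)
  (S : set 'rV[int]_d) (hS : lattice_unbounded R S)
  (disp : measure_display) (Omega : measurableType disp)
  (Pr : 'rV[int]_d -> probability Omega R)
  (xi : nat -> Omega -> 'rV[int]_d)
  (hchain : markov_chain S Pr xi)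
  (hA1 : A1 S Pr xi)
  (hA2 : A2 S Pr xi)
  (mu : 'rV[int]_d -> 'rV[R]_d)
  (hmu : is_drift S Pr xi mu)
  (beta c delta A0 : R)
  (hbeta : 0 < beta < 1) (hc : 0 < c) (hdelta : 0 < delta) (hA0 : 0 < A0)
  (hradial : forall x, S x -> A0 < enorm (emb R x) ->
     c <= (enorm (emb R x) `^ beta) * dotp (mu x) (hat (emb R x)))
  (htransverse :
     (ereal_sup [set ereal_sup
        [set ((enorm (emb R x) `^ (beta + delta)) * `|dotp (mu x) u|)%R%:E
           | u in [set u | unit_sphere R d u /\ dotp u (emb R x) = 0%R]]
        | x in [set x | S x /\ (A0 < enorm (emb R x))%R]] < +oo)%E) :
  forall x0, S x0 ->
    {ae Pr x0, forall w, enorm (emb R (xi t w)) @[t --> \oo] --> +oo}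
    /\ exists v : Omega -> 'rV[R]_d,
        [/\ random_vector v,
            forall w, unit_sphere R d (v w),
            law_support (Pr x0) v = unit_sphere R d
          & {ae Pr x0, forall w, hat (emb R (xi t w)) @[t --> \oo] --> v w}].
Proof.
have [kappa [k [n0 [kap0 k0 step]]]] := A1_step hchain hA1.
have [B0 [B00 hB0]] := hA2.
have /andP[beta0 beta1] := hbeta.
have mS := measurable_at_state hchain.
have inS := chain_in_S hchain.
have i0 : 'I_d by exists 0; exact: leq_trans hd.
have [K K0 hK] : exists2 K : R, 0 <= K & forall x, S x -> A0 < enorm (emb R x) ->
    forall p, enorm p = 1 -> dotp p (emb R x) = 0 ->
    enorm (emb R x) `^ (beta + delta) * `|dotp (mu x) p| <= K.
  move: htransverse; set s := ereal_sup _ => hs.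
  exists (Num.max 0 (fine s)) => [|x Sx xA p p1 px]; first by rewrite le_max lexx.
  rewrite le_max; apply/orP; right; rewrite -lee_fin.
  set val := _ * _.
  have vs : (val%:E <= s)%E.
    apply: le_trans (ereal_sup_ubound _); last by exists x => //; split.
    by apply: ereal_sup_ubound; exists p.
  by rewrite fineK// fin_numE -ltey hs andbT gt_eqF// (lt_le_trans _ vs)// ltNyr.
(* The entries delta and 1 - beta are those of [lyap_drift]; the entry 1 ensures a < 1. *)
pose a := Num.min (Num.min delta (1 - beta)) 1 / 4.
have a_le (z : R) : Num.min (Num.min delta (1 - beta)) 1 <= z -> 4 * a <= z.
  by rewrite /a mulrCA mulfV// mulr1.
have ad : 4 * a <= delta by apply: a_le; rewrite !ge_min lexx.
have ab : 4 * a <= 1 - beta by apply: a_le; rewrite !ge_min lexx orbT.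
have a4 : 4 * a <= 1 by apply: a_le; rewrite ge_min lexx orbT.
have a0 : 0 < a.
  by rewrite divr_gt0// !lt_min hdelta ltr01 subr_gt0 beta1.
have a01 : 0 < a < 1 by rewrite a0/=; lra.
have KB : 0 < K + 37 * B0 by rewrite ltr_wpDl// mulr_gt0.
have a2 : 0 < 2 * a by rewrite mulr_gt0.
have [N N0 hN] := powRN_small a2 (divr_gt0 (mulr_gt0 a2 hc) KB).
(* A0 + 2 gives both |x| > A0 for the drift bounds and |x| >= 2 for the expansion; N makes the
   radial gain dominate. *)
pose rho0 := Num.max (A0 + 2) N.
have rho_A0 : A0 + 2 <= rho0 by rewrite le_max lexx.
have rho_N : N <= rho0 by rewrite le_max lexx orbT.
have rho_ge1 : 1 <= rho0 by lra.
have lyap_super (u : 'rV[R]_d) x : enorm u = 1 -> S x ->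
    rho0 <= enorm (emb R x) ->
    (\int[Pr x]_(w in at_state xi 0 x) (lyap a u (emb R (xi 1 w)))%:E
      <= (lyap a u (emb R x))%:E)%E.
  move=> u1 Sx xA.
  have Px : Pr x (at_state xi 0 x) != 0%E.
    by rewrite (Pr_at_state0 hchain Sx) onee_neq0.
  apply: (integral_lyap_le hchain (B := B0) (m := mu x)) => //.
  - lra.
  - by move=> i; exact: (hmu 0%N x Sx x Sx Px i).
  - exact: (hB0 0%N x Sx x Sx Px).
  have xA0 : A0 < enorm (emb R x) by lra.
  apply: (@lyap_drift _ _ a beta c delta K B0) => //.
  - exact: ltW.
  - lra.
  - have rp : 0 < enorm (emb R x) by lra.
    have := hN _ (le_trans rho_N xA).
    by rewrite powRN ler_pdivlMr// mulrC ler_pdivrMr ?powR_gt0.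
  - exact: hradial.
  - exact: hK.
move=> x0 Sx0.
have exits M y : S y ->
    Pr y [set w | forall t, enorm (emb R (xi t w)) < M] = 0%E.
  exact: (exit_ball hchain kap0 k0 step i0 M).
pose W n := [set w | forall m, exists s, strays (rho0 + n%:R) n.+1%:R^-1
  (hat (emb R (xi m w))) (xi (m + s)%N w)].
have mW n : measurable (W n) by exact: (measurable_wanders hchain).
have W0 n : Pr x0 (W n) = 0%E.
  by apply: (wanders_null hchain a01 rho_ge1 lyap_super exits) => //; rewrite lerDl.
pose G := ~` \bigcup_n W n.
have mU : measurable (\bigcup_n W n) by exact: bigcupT_measurable.
have mG : measurable G by exact: measurableC.
have null : (Pr x0).-negligible (~` G).
  by rewrite setCK; apply: negligible_bigcup => n; exists (W n); split=> //;
    exact: W0.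
have GP w : G w -> enorm (emb R (xi t w)) @[t --> \oo] --> +oo /\
    exists2 l : 'rV[R]_d, enorm l = 1 & hat (emb R (xi t w)) @[t --> \oo] --> l.
  move=> Gw; apply: (direction_cvg rho_ge1) => n.
  have [[m hm]|nm] := pselect (exists m, forall s,
      ~ strays (rho0 + n%:R) n.+1%:R^-1 (hat (emb R (xi m w))) (xi (m + s)%N w)).
    by exists m.
  exfalso; apply: Gw; exists n => // m; apply: contrapT => ns; apply: nm.
  by exists m => s hs; apply: ns; exists s.
split; first by apply: negligibleS null => w nw Gw; apply: nw; case: (GP w Gw).
pose e0 : 'rV[R]_d := emb R (delta_mx 0 i0).
(* Off the full event G the direction is replaced by a fixed unit vector, so that v is a unit vector
   everywhere and a pointwise limit everywhere. *)
pose h t w := if `[< G w >] then hat (emb R (xi t w)) else e0.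
pose v w := lim (h t w @[t --> \oo]).
have hv w : [/\ enorm (v w) = 1 & h t w @[t --> \oo] --> v w].
  rewrite /v /h; case: asboolP => Gw.
    by have [_ [l l1 hl]] := GP w Gw; rewrite (cvg_lim _ hl).
  by rewrite lim_cst//; split; [exact: enorm_emb_delta|exact: cvg_cst].
have mv i : measurable_fun [set: Omega] (fun w => v w 0 i).
  apply: (@measurable_fun_cvg _ _ _ _ (fun t w => h t w 0 i)).
    (* G depends on the whole path, so its truth value is paired with the state at time t; the pair
       is still countably valued. *)
    move=> t; pose X w := (xi t w, `[< G w >]).
    have mX p : measurable (X @^-1` [set p]).
      rewrite [_ @^-1` _](_ : _ = at_state xi t p.1 `&`
          (if p.2 then G else ~` G)).
        by apply: measurableI => //; case: ifP => // _; exact: measurableC.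
      case: p => y b; apply/seteqP; split=> w.
        by case=> <- <- /=; split=> //; case: asboolP.
      case=> /= wy; rewrite /X (wy : xi t w = y).
      by case: b => Gw; congr (_, _); [apply/asboolP|apply/asboolPn].
    exact: (measurable_fun_countable
      (fun p => (if p.2 then hat (emb R p.1) else e0) 0 i) mX measurableT).
  move=> w _; have [_ hw] := hv w.
  exact: (continuous_cvg _ (@coord_continuous _ _ _ 0 i (v w)) hw).
exists v; split=> //.
- by move=> w; case: (hv w).
- apply/seteqP; split=> u.
    move=> hu; apply: contrapT => u1.
    (* The open ball around u of this radius misses the sphere, on which v always lies. *)
    have e1 : 0 < `|1 - enorm u|.
      by rewrite normr_gt0 subr_eq0 eq_sym; apply/eqP.
    have := hu _ e1; rewrite [X in Pr x0 X](_ : _ = set0) ?measure0 ?ltxx//.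
    rewrite -subset0 => w /=; rewrite ltNge => /negP; apply.
    have [v1 _] := hv w.
    have := enormD (v w - u) u; have := enormD (u - v w) (v w).
    rewrite !subrK -(enormN (u - _)) opprB v1 => ? ?.
    by rewrite ler_norml; apply/andP; split; lra.
  move=> u1 e ep; rewrite /unit_sphere /= in u1.
  (* In the cone, the squared distance to u is below 2 eta = (e/2)^2; the other e/2 is spent on
     passing to the limit. *)
  pose eta := e ^+ 2 / 8.
  have eta0 : 0 < eta by rewrite divr_gt0// exprn_gt0.
  have th0 := threshold_gt0 a rho_ge1 (lexx rho0) eta0.
  (* Half the threshold makes the probability of straying, once at y, at most 1/2. *)
  have [z hz] := @small_lyap_in_direction _ _ a (threshold a rho0 eta / 2) u x0 k
    a0 (divr_gt0 th0 (ltr0n _ 2)) u1 k0.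
  have [n [p p0 hp]] := reach_lattice hchain kap0 step z Sx0.
  set y := (x0 + z *+ k)%R in hz hp.
  have Sy := state_in_S hchain p0 hp.
  pose H := at_state xi n y.
  pose T := [set w | exists s, strays rho0 eta u (xi (n + s)%N w)].
  have mT : measurable T.
    rewrite (_ : T = \bigcup_s [set w | strays rho0 eta u (xi (n + s)%N w)]).
      apply: bigcupT_measurable => s.
      exact: (measurable_xi hchain _ (strays rho0 eta u)).
    by apply/seteqP; split=> w [s]; [exists s|move=> _; exists s].
  have hH : historical xi n H by exact: (historical_state (D := [set y])).
  have HT : (Pr x0 (H `&` T) <= (2^-1)%:E * Pr x0 H)%E.
    apply: le_trans (prob_strays_le hchain a01 rho_ge1 lyap_super (lexx rho0) eta0
      u1 Sx0 Sy hH (@subset_refl _ _)) _.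
    by rewrite lee_wpmul2r// lee_fin ler_pdivrMr// mulrC.
  pose V := [set w | enorm (v w - u) < e].
  have mV : measurable V.
    have -> : V = [set w | \sum_(i < d) (v w 0 i - u 0 i) ^+ 2 < e ^+ 2].
      have VE w : (enorm (v w - u) < e)
          = (\sum_(i < d) (v w 0 i - u 0 i) ^+ 2 < e ^+ 2).
        rewrite -(@ltr_pXn2r _ 2)// ?nnegrE ?enorm_ge0 ?(ltW ep)//.
        by rewrite sqr_enorm; congr (_ < _); apply: eq_bigr => i _;
          rewrite !mxE.
      by apply/seteqP; split=> w; rewrite /V /= VE.
    rewrite -[X in measurable X]setTI.
    apply: (@measurable_fun_ltr _ _ _ setT (fun w => \sum_(i < d) _)
       (cst (e ^+ 2))) => //.
    apply: measurable_sum => i; apply: measurable_funX.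
    by apply: measurable_funB => //; exact: mv.
  have HV : H `&` ~` T `&` G `<=` V.
    move=> w [[Hw nT] Gw]; have [_] := hv w.
    rewrite /h asboolT// => hw.
    have [N1 _ hN1] := cvg_enorm_lt hw (divr_gt0 ep (ltr0n _ 2)).
    have := hN1 (n + N1)%N (leq_addl _ _); rewrite /= => d1.
    have [xA xe] : rho0 <= enorm (emb R (xi (n + N1)%N w)) /\
        1 - dotp (hat (emb R (xi (n + N1)%N w))) u < eta.
      split.
        by rewrite leNgt; apply/negP => ?; apply: nT; exists N1; left.
      by rewrite ltNge; apply/negP => ?; apply: nT; exists N1; right.
    have x1 : enorm (hat (emb R (xi (n + N1)%N w))) = 1.
      apply: enorm_hat; apply: contraTneq xA => ->.
      by rewrite enorm0 -ltNge; lra.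
    have d2 : enorm (hat (emb R (xi (n + N1)%N w)) - u) <= e / 2.
      rewrite -(@ler_pXn2r _ 2)// ?nnegrE ?enorm_ge0 ?divr_ge0 ?(ltW ep)//.
      by rewrite sqr_enorm_unitB// expr_div_n; rewrite /eta in xe; lra.
    rewrite /V /=.
    have -> : v w - u = (v w - hat (emb R (xi (n + N1)%N w)))
        + (hat (emb R (xi (n + N1)%N w)) - u) by rewrite addrA subrK.
    by apply: le_lt_trans (enormD _ _) _; lra.
  have HP : (Pr x0 H <= Pr x0 (H `&` T) + Pr x0 V)%E.
    have mC := measurableC mG.
    have GU : Pr x0 (~` G) = 0%E by exact: (negligibleP _ mC).1 null.
    have cover : H `<=` ((H `&` T) `|` V) `|` ~` G.
      move=> w Hw; have [Gw|] := pselect (G w); last by right.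
      left; have [Tw|nT] := pselect (T w); [by left|right].
      exact: HV.
    have mHT : measurable (H `&` T) by apply: measurableI => //; exact: mS.
    apply: le_trans (le_measure _ _ _ cover) _; rewrite ?inE.
    + exact: mS.
    + by apply: measurableU => //; exact: measurableU.
    apply: le_trans (measureU2 _ _ _) _ => //=; first exact: measurableU.
    by rewrite GU adde0; exact: measureU2.
  (* If V were null, H would have at most half its own probability, against Pr H >= p > 0. *)
  rewrite -/V; apply: contraTT isT => nV.
  have V0 : Pr x0 V = 0%E.
    by apply/eqP; rewrite eq_le measure_ge0 andbT leNgt.
  move: HP; rewrite V0 adde0 => /le_trans/(_ HT).
  rewrite -[Pr x0 H]fineK ?fin_num_measure//; last exact: mS.
  rewrite -EFinM lee_fin => h2.
  move: hp; rewrite -/H -[Pr x0 H]fineK ?fin_num_measure//; last exact: mS.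
  rewrite lee_fin => h3; lra.
- apply: negligibleS null => w nw Gw; apply: nw => /=.
  by have [_] := hv w; rewrite /h asboolT.
Qed.
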